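(* Let $\pi:E\to B$ be a fiber bundle and let $\{\Pi_t\}_{t\in[0,1]}$ be a smooth family of coupling Poisson tensors on $E$ associated with geometric data $(\Upsilon,\Gamma^t,F^t)$, where the vertical part $\Upsilon$ does not depend on $t$. Assume that (a) there is a smooth family $Q^t\in\Omega^1(B)\otimes C^\infty(E)$ such that $\mathrm{hor}^{\Gamma^t}(u)=\mathrm{hor}^{\Gamma^0}(u)+\Upsilon^\natural dQ^t(u)$ for every $t\in[0,1]$ and every vector field $u$ on $B$; (b) $\{\Pi_t\}$ admits an infinitesimal generator of the form $Z_t=X_t+\Upsilon^\natural dh_t$, where $X_t$ is $\Gamma^t$-horizontal and $h_t\in C^\infty(E)$ is a time-dependent function. Then the family $\{Q^t\}$ in (a) can be chosen such that in addition $$F^t=F^0-\Big(\partial^{\Gamma^0}Q^t+\tfrac12\{Q^t\wedge Q^t\}_\Upsilon\Big)\qquad\text{for every } t\in[0,1].$$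
   Context: Everything is smooth (families are smooth in $t$). $\mathbb V=\ker d\pi\subset TE$, $\mathbb V^0\subset T^*E$ its annihilator. For a bivector field $\Pi$ on $E$, $\Pi^\natural:T^*E\to TE$ is $\langle\beta,\Pi^\natural(\alpha)\rangle=\Pi(\alpha,\beta)$. An Ehresmann connection $\Gamma$ is a subbundle $\mathbb H$ with $TE=\mathbb H\oplus\mathbb V$; $\mathrm{hor}^\Gamma(u)$ is the horizontal lift of a vector field $u$ on $B$. $\Omega^k(B)\otimes C^\infty(E)$ (over $C^\infty(B)$) is the space of $k$-forms on $B$ with values in $C^\infty(E)$; for such $\Theta$, $\pi^*\Theta$ is the horizontal $k$-form on $E$ with $(\pi^*\Theta)(\mathrm{hor}^\Gamma(u_1),\dots)=\Theta(u_1,\dots)$, and $$(\partial^{\Gamma}\Theta)(u_0,\dots,u_k)=\sum_{i}(-1)^i L_{\mathrm{hor}^\Gamma(u_i)}\Theta(u_0,\dots,\hat u_i,\dots,u_k)+\sum_{i<j}(-1)^{i+j}\Theta([u_i,u_j],u_0,\dots,\hat u_i,\dots,\hat u_j,\dots,u_k).$$ A coupling Poisson tensor is a Poisson bivector field $\Pi$ such that $\mathbb H=\Pi^\natural(\mathbb V^0)$ is complementary to $\mathbb V$ everywhere; then $\mathbb H$ defines a connection $\Gamma$, $\Pi=\Pi_H+\Pi_V$ with $\Pi_H$ horizontal and $\Pi_V$ vertical, and there is a unique $F\in\Omega^2(B)\otimes C^\infty(E)$ (the coupling form), nondegenerate at each point of $E$, with $\Pi_H(\beta_1,\beta_2)=(\pi^*F)(\Pi_H^\natural\beta_1,\Pi_H^\natural\beta_2)$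 for sections $\beta_i$ of $\mathbb V^0$. $(\Pi_V,\Gamma,F)$ is the geometric data of $\Pi$; it determines $\Pi$. The vertical part $\Pi_V$ is itself a Poisson tensor. With $\{f,h\}_\Upsilon=\Upsilon(df,dh)$, for $Q\in\Omega^1(B)\otimes C^\infty(E)$, $\{Q\wedge Q\}_\Upsilon(u_0,u_1)=\{Q(u_0),Q(u_1)\}_\Upsilon-\{Q(u_1),Q(u_0)\}_\Upsilon$. An infinitesimal generator of $\{\Pi_t\}$ is a time-dependent vector field $Z_t$ on $E$ with $L_{Z_t}\Pi_t+\partial\Pi_t/\partial t=0$. *)

(* Defs.v *)
From HB Require Import structures.
From mathcomp Require Import all_boot all_order all_algebra.
From mathcomp Require Import all_classical all_reals all_analysis.
From mathcomp Require Import ring.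
Set Implicit Arguments.
Unset Strict Implicit.
Unset Printing Implicit Defensive.
Import Order.TTheory GRing.Theory Num.Theory.
Import numFieldNormedType.Exports.
Local Open Scope classical_set_scope.
Local Open Scope ring_scope.

(* [l] is the derivative of [f] at [x] along [v], the increments being
   restricted to those that stay in [D]: the usual directional derivative when
   [D] is open, a one-sided derivative at the end points of an interval. *)
Definition is_derive_in (R : realType) (V : lmodType R) (D : set V)
    (f : V -> R) (x v : V) (l : R) : Prop :=
  (fun h : R => h^-1 * (f (x + h *: v) - f x))
    @ within [set h | D (x + h *: v)] 0^' --> l.

Fixpoint Ck_on (R : realType) (n k : nat) (D : set 'rV[R]_n)
    (f : 'rV[R]_n -> R) {struct k} : Prop :=
  {within D, continuous f} /\
  if k is k'.+1 then
    forall i : 'I_n, exists2 g : 'rV[R]_n -> R,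
      forall x, D x -> is_derive_in D f x (delta_mx 0 i) (g x) & Ck_on k' D g
  else True.

(* Used for open [D] and for [0, 1] x (open set); in the second case this is
   smoothness up to the boundary. *)
Definition smooth_on (R : realType) (n : nat) (D : set 'rV[R]_n)
    (f : 'rV[R]_n -> R) : Prop := forall k, Ck_on k D f.

Section SmoothOn.
Context {R : realType}.

Lemma is_derive_in_cst (V : lmodType R) (D : set V) (a : R) (x v : V) :
  is_derive_in D (cst a) x v 0.
Proof.
rewrite /is_derive_in; under eq_fun do rewrite subrr mulr0.
exact: cvg_cst.
Qed.

Lemma is_derive_inD (V : lmodType R) (D : set V) (f g : V -> R) x v a b :
  is_derive_in D f x v a -> is_derive_in D g x v b ->
  is_derive_in D (f + g) x v (a + b).
Proof.
rewrite /is_derive_in => fa gb.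
rewrite (_ : (fun h => _) =
  (fun h : R => h^-1 * (f (x + h *: v) - f x)) +
  (fun h : R => h^-1 * (g (x + h *: v) - g x))); first exact: cvgD.
by apply/funext => h; rewrite !fctE -mulrDr opprD addrACA.
Qed.

Lemma is_derive_inM (V : lmodType R) (D : set V) (f g : V -> R) x v a b :
  is_derive_in D f x v a -> is_derive_in D g x v b ->
  is_derive_in D (f * g) x v (a * g x + f x * b).
Proof.
rewrite /is_derive_in => fa gb.
set F := within _ _.
have FF : Filter F by apply: within_filter.
have hneq0 : \forall h \near F, h != 0.
  exact: (cvg_within _ (nbhs_dnbhs_neq (0 : R))).
have h0 : (fun h : R => h) @ F --> (0 : R).
  by move=> A /nbhs_dnbhs A0; exact: (cvg_within _ A0).
have gc : (fun h => g (x + h *: v)) @ F --> g x.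
  have e : \forall h \near F,
      h * (h^-1 * (g (x + h *: v) - g x)) + g x = g (x + h *: v).
    near=> h; rewrite mulrA divff ?mul1r ?subrK //.
    by near: h.
  apply: cvg_trans (near_eq_cvg e) _.
  have := cvgD (cvgM h0 gb) (cvg_cst (g x)).
  by rewrite mul0r add0r; apply.
rewrite (_ : (fun h => _) =
  (fun h : R => h^-1 * (f (x + h *: v) - f x)) *
    (fun h => g (x + h *: v)) +
  cst (f x) * (fun h : R => h^-1 * (g (x + h *: v) - g x))).
  by apply: cvgD; apply: cvgM => //; apply: cvg_cst.
apply/funext => h; rewrite !fctE /= [f x * (_ * _)]mulrCA -[_^-1 * _ * _]mulrA -mulrDr.
congr (_ * _).
by rewrite mulrBl mulrBr addrA subrK.
Unshelve. all: by end_near. Qed.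

Lemma Ck_onS n k (D : set 'rV[R]_n) f : Ck_on k.+1 D f -> Ck_on k D f.
Proof.
elim: k f => [|k IH] f [cf df]; first by split.
split=> // i; have [g fg /IH gk] := df i.
by exists g.
Qed.

Lemma Ck_on_continuous n k (D : set 'rV[R]_n) f :
  Ck_on k D f -> {within D, continuous f}.
Proof. by case: k => [|k] []. Qed.

Lemma Ck_on_cst n k (D : set 'rV[R]_n) (a : R) : Ck_on k D (cst a).
Proof.
elim: k a => [|k IH] a; split=> //; try by move=> x; apply: cvg_cst.
by move=> i; exists (cst 0) => // x _; exact: is_derive_in_cst.
Qed.

Lemma Ck_onD n k (D : set 'rV[R]_n) f g :
  Ck_on k D f -> Ck_on k D g -> Ck_on k D (f + g).
Proof.
elim: k f g => [|k IH] f g [cf df] [cg dg]; split=> //.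
- by move=> x; apply: cvgD; [exact: cf|exact: cg].
- by move=> x; apply: cvgD; [exact: cf|exact: cg].
move=> i; have [f' f'P f'k] := df i; have [g' g'P g'k] := dg i.
exists (f' + g'); last exact: IH.
by move=> x Dx; apply: is_derive_inD; [exact: f'P|exact: g'P].
Qed.

Lemma Ck_onM n k (D : set 'rV[R]_n) f g :
  Ck_on k D f -> Ck_on k D g -> Ck_on k D (f * g).
Proof.
elim: k f g => [|k IH] f g fk gk; have cf := Ck_on_continuous fk;
  have cg := Ck_on_continuous gk; split=> //.
- by move=> x; apply: cvgM; [exact: cf|exact: cg].
- by move=> x; apply: cvgM; [exact: cf|exact: cg].
move=> i; have [f' f'P f'k] := fk.2 i; have [g' g'P g'k] := gk.2 i.
exists (f' * g + f * g').
  by move=> x Dx; apply: is_derive_inM; [exact: f'P|exact: g'P].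
by apply: Ck_onD; apply: IH => //; apply: Ck_onS.
Qed.

End SmoothOn.

Record chart (R : realType) (M : topologicalType) (n : nat) := Chart {
  cdom : set M;
  cmap : M -> 'rV[R]_n;
  cinv : 'rV[R]_n -> M;
  cdom_open : open cdom;
  cimg_open : open (cmap @` cdom);
  cmapK : forall x, cdom x -> cinv (cmap x) = x;
  cmap_continuous : {within cdom, continuous cmap};
  cinv_continuous : {within cmap @` cdom, continuous cinv} }.

Definition cimg (R : realType) (M : topologicalType) n (c : chart R M n) :
  set 'rV[R]_n := cmap c @` cdom c.

(* The atlas need not be maximal. *)
Record manifold (R : realType) := Manifold {
  mdim : nat;
  mtop :> topologicalType;
  atlas : set (chart R mtop mdim);
  atlas_cover : forall x : mtop, exists2 c, atlas c & cdom c x;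
  atlas_smooth : forall c c', atlas c -> atlas c' -> forall i,
    smooth_on (cmap c @` (cdom c `&` cdom c'))
      (fun x => cmap c' (cinv c x) 0 i);
  manifold_hausdorff : hausdorff_space mtop;
  manifold_second_countable : @second_countable mtop }.

Section Maps.
Context {R : realType}.

Definition smooth_map_on (M N : manifold R) (W : set M) (g : M -> N) : Prop :=
  {within W, continuous g} /\
  forall c c', atlas c -> atlas c' -> forall i,
    smooth_on (cmap c @` (cdom c `&` W `&` g @^-1` cdom c'))
      (fun x => cmap c' (g (cinv c x)) 0 i).

(* Smoothness of a map U x N -> E, in the product charts of U x N. *)
Definition smooth_map2_on (B N E : manifold R) (U : set B)
    (s : B -> N -> E) : Prop :=
  {within U `*` [set: N], continuous (fun q : B * N => s q.1 q.2)} /\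
  forall cB cN cE, atlas cB -> atlas cN -> atlas cE -> forall i,
    let s' (z : 'rV[R]_(mdim B + mdim N)) :=
      s (cinv cB (lsubmx z)) (cinv cN (rsubmx z)) in
    smooth_on
      [set z | [/\ cimg cB (lsubmx z), cimg cN (rsubmx z),
                   U (cinv cB (lsubmx z)) & cdom cE (s' z)]]
      (fun z => cmap cE (s' z) 0 i).

(* (pi, chi) : pi^-1(U) -> U x N is a diffeomorphism, with inverse s. *)
Definition local_trivialization (E B N : manifold R) (pi : E -> B) (U : set B)
    (chi : E -> N) (s : B -> N -> E) : Prop :=
  [/\ smooth_map_on (pi @^-1` U) chi,
      smooth_map2_on U s,
      (forall e, U (pi e) -> s (pi e) (chi e) = e) &
      (forall b y, U b -> pi (s b y) = b /\ chi (s b y) = y)].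

Definition fiber_bundle (E B : manifold R) (pi : E -> B) : Prop :=
  [/\ smooth_map_on setT pi,
      (forall b, exists e, pi e = b) &
      exists N : manifold R, forall b : B, exists U : set B,
        [/\ open U, U b & exists chi s,
            @local_trivialization E B N pi U chi s]].

Definition smooth_fun (M : manifold R) : {pred M -> R} :=
  fun f => `[< forall c, atlas c -> smooth_on (cimg c) (f \o cinv c) >].

Lemma smooth_fun_subring (M : manifold R) : subring_closed (@smooth_fun M).
Proof.
have cstS (a : R) : cst a \in @smooth_fun M.
  by apply/asboolP => c _ k; exact: (@Ck_on_cst R _ _ _ a).
have addS (f g : M -> R) : f \in @smooth_fun M -> g \in @smooth_fun M ->
    f + g \in @smooth_fun M.
  move=> /asboolP fs /asboolP gs; apply/asboolP => c cA k.
  by apply: Ck_onD; [exact: fs|exact: gs].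
have mulS (f g : M -> R) : f \in @smooth_fun M -> g \in @smooth_fun M ->
    f * g \in @smooth_fun M.
  move=> /asboolP fs /asboolP gs; apply/asboolP => c cA k.
  by apply: Ck_onM; [exact: fs|exact: gs].
split=> [|f g fs gs|]; [exact: cstS| |exact: mulS].
apply: addS => //; rewrite (_ : - g = cst (-1) * g); first exact: mulS.
by apply/funext => x; rewrite !fctE mulN1r.
Qed.

Lemma smooth_fun_scale (M : manifold R) : scaler_closed (@smooth_fun M).
Proof.
move=> a f /asboolP fs; apply/asboolP => c cA k.
exact: (Ck_onM (Ck_on_cst _ _ a) (fs c cA k)).
Qed.

End Maps.

HB.instance Definition _ (R : realType) (M : manifold R) :=
  GRing.isSubringClosed.Build (M -> R) (@smooth_fun R M)
    (@smooth_fun_subring R M).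
HB.instance Definition _ (R : realType) (M : manifold R) :=
  GRing.isScaleClosed.Build R (M -> R) (@smooth_fun R M)
    (@smooth_fun_scale R M).

Record Cinf (R : realType) (M : manifold R) := MkCinf {
  cinf_fun :> M -> R;
  _ : cinf_fun \in @smooth_fun R M }.

HB.instance Definition _ (R : realType) (M : manifold R) :=
  [isSub of Cinf M for @cinf_fun R M].
HB.instance Definition _ (R : realType) (M : manifold R) :=
  [Choice of Cinf M by <:].
HB.instance Definition _ (R : realType) (M : manifold R) :=
  GRing.SubChoice_isSubComPzRing.Build (M -> R) (@smooth_fun R M) (Cinf M)
    (@smooth_fun_subring R M).
HB.instance Definition _ (R : realType) (M : manifold R) :=
  [SubZmodule_isSubLmodule of Cinf M by <:].

(* A vector field is a derivation of the algebra of smooth functions; its value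
   at [x], as a derivation at [x], is [vat X x]. *)
Record vfield (R : realType) (M : manifold R) := VField {
  vf_fun :> Cinf M -> Cinf M;
  vf_linear : forall (a : R) f g, vf_fun (a *: f + g) = a *: vf_fun f + vf_fun g;
  vf_leibniz : forall f g, vf_fun (f * g) = vf_fun f * g + f * vf_fun g }.

(* A bivector field is a skew-symmetric biderivation: [P f g] is the function
   P(df, dg), so that [P f] is the vector field P^natural(df). *)
Record bivector (R : realType) (M : manifold R) := Bivector {
  bv_fun :> Cinf M -> Cinf M -> Cinf M;
  bv_skew : forall f g, bv_fun f g = - bv_fun g f;
  bv_linear : forall f (a : R) g h,
    bv_fun f (a *: g + h) = a *: bv_fun f g + bv_fun f h;
  bv_leibniz : forall f g h,
    bv_fun f (g * h) = bv_fun f g * h + g * bv_fun f h }.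

Section Tensors.
Context {R : realType}.
Implicit Types M : manifold R.

Definition vat M (X : vfield M) (x : M) : Cinf M -> R := fun f => X f x.

(* The tangent space of [M] at [x]: the derivations at [x]. *)
Definition tangent M (x : M) : set (Cinf M -> R) :=
  [set v | (forall (a : R) (f g : Cinf M), v (a *: f + g) = a * v f + v g) /\
           (forall f g : Cinf M, v (f * g) = v f * g x + f x * v g)].

Lemma CinfDE M (f g : Cinf M) x : (f + g) x = f x + g x. Proof. by []. Qed.
Lemma CinfME M (f g : Cinf M) x : (f * g) x = f x * g x. Proof. by []. Qed.
Lemma CinfZE M a (f : Cinf M) x : (a *: f) x = a * f x. Proof. by []. Qed.
Lemma CinfNE M (f : Cinf M) x : (- f) x = - f x. Proof. by []. Qed.
Definition CinfE M := (@CinfDE M, @CinfME M, @CinfZE M, @CinfNE M).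

Lemma Cinf_eq M (f g : Cinf M) : (forall x, f x = g x) -> f = g.
Proof. by move=> fg; apply/val_inj/funext. Qed.

Definition vfield_add M (X Y : vfield M) : vfield M.
Proof.
exists (fun f => X f + Y f) => [a f g|f g].
- by rewrite !vf_linear scalerDr addrACA.
- by rewrite !vf_leibniz mulrDl mulrDr addrACA.
Defined.

Definition vfield_scale M (b : Cinf M) (X : vfield M) : vfield M.
Proof.
exists (fun f => b * X f) => [a f g|f g].
- by rewrite vf_linear; apply: Cinf_eq => x; rewrite !CinfE; ring.
- by rewrite vf_leibniz; ring.
Defined.

Definition lie_bracket M (X Y : vfield M) : vfield M.
Proof.
exists (fun f => X (Y f) - Y (X f)) => [a f g|f g].
- by rewrite !vf_linear; apply: Cinf_eq => x; rewrite !CinfE; ring.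
- rewrite !vf_leibniz.
  have D (Z : vfield M) (h k : Cinf M) : Z (h + k) = Z h + Z k.
    by rewrite -[h]scale1r vf_linear !scale1r.
  by rewrite !D !vf_leibniz; ring.
Defined.

Definition sharp M (P : bivector M) (f : Cinf M) : vfield M :=
  VField (bv_linear P f) (bv_leibniz P f).

(* Vanishing of the Schouten bracket [P, P]: the Jacobi identity. *)
Definition poisson M (P : bivector M) : Prop :=
  forall f g h, P f (P g h) + P g (P h f) + P h (P f g) = 0.

(* (L_X P)(df, dg) *)
Definition lie_derivative M (X : vfield M) (P : bivector M) (f g : Cinf M) :
  Cinf M := X (P f g) - P (X f) g - P f (X g).

Definition unit_interval : set R := [set t | 0 <= t <= 1].

Definition smooth_family M (f : R -> Cinf M) : Prop :=
  forall c, @atlas R M c ->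
    smooth_on
      [set z : 'rV[R]_(1 + mdim M) |
        unit_interval (z 0 0) /\ cimg c (rsubmx z)]
      (fun z => f (z 0 0) (cinv c (rsubmx z))).

Definition smooth_vfamily M (X : R -> vfield M) : Prop :=
  forall f, smooth_family (fun t => X t f).

Definition smooth_bfamily M (P : R -> bivector M) : Prop :=
  forall f g, smooth_family (fun t => P t f g).

(* L_{Z_t} P_t + dP_t/dt = 0 *)
Definition infinitesimal_generator M (P : R -> bivector M)
    (Z : R -> vfield M) : Prop :=
  smooth_vfamily Z /\
  forall t, unit_interval t -> forall f g x,
    is_derive_in (unit_interval : set R^o) (fun s => P s f g x) t 1
      (- lie_derivative (Z t) (P t) f g x).

End Tensors.

Section Bundle.
Context {R : realType} {E B : manifold R} (pi : E -> B).

Definition pulled_back (f : Cinf E) (b : Cinf B) : Prop :=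
  forall e, f e = b (pi e).

(* d_e pi (v) = w; as [pi] is smooth, every [b] is pulled back to some [f]. *)
Definition dpi (v : Cinf E -> R) (w : Cinf B -> R) : Prop :=
  forall f b, pulled_back f b -> v f = w b.

Definition vertical (e : E) : set (Cinf E -> R) :=
  [set v | tangent e v /\ dpi v (cst 0)].

(* Covectors at [e] are the differentials d_e f; this says that d_e f lies in
   the annihilator of the vertical space at [e]. *)
Definition annihilates_vertical (e : E) (f : Cinf E) : Prop :=
  forall v, vertical e v -> v f = 0.

Definition complementary_to_vertical
    (H : forall e : E, set (Cinf E -> R)) : Prop :=
  forall e, (forall v, H e v -> vertical e v -> v = cst 0) /\
    (forall v, tangent e v ->
       exists h w, [/\ H e h, vertical e w & v = h + w]).

(* A distribution H complementary to the vertical bundle is a smooth subbundle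
   exactly when the horizontal lifts of smooth vector fields are smooth; these
   lifts, uniquely determined by H, are recorded in [hor]. *)
Record connection := Connection {
  hspace : forall e : E, set (Cinf E -> R);
  hspace_tangent : forall e, hspace e `<=` tangent e;
  hspace_linear : forall e (a : R) v w,
    hspace e v -> hspace e w -> hspace e (fun f => a * v f + w f);
  hspace_compl : complementary_to_vertical hspace;
  hor : vfield B -> vfield E;
  hor_hspace : forall u e, hspace e (vat (hor u) e);
  hor_lift : forall u e, dpi (vat (hor u) e) (vat u (pi e)) }.

Record form1 := Form1 {
  form1_fun :> vfield B -> Cinf E;
  form1D : forall u v, form1_fun (vfield_add u v) = form1_fun u + form1_fun v;
  form1Z : forall b u e,
    form1_fun (vfield_scale b u) e = b (pi e) * form1_fun u e }.

Record form2 := Form2 {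
  form2_fun :> vfield B -> vfield B -> Cinf E;
  form2_alt : forall u v, form2_fun u v = - form2_fun v u;
  form2D : forall u v w,
    form2_fun u (vfield_add v w) = form2_fun u v + form2_fun u w;
  form2Z : forall b u v e,
    form2_fun u (vfield_scale b v) e = b (pi e) * form2_fun u v e }.

Definition smooth_form1_family (Q : R -> form1) : Prop :=
  forall u, smooth_family (fun t => Q t u).

Definition smooth_form2_family (F : R -> form2) : Prop :=
  forall u v, smooth_family (fun t => F t u v).

Definition smooth_connection_family (G : R -> connection) : Prop :=
  forall u, smooth_vfamily (fun t => hor (G t) u).

Definition nondegenerate_at (F : form2) (e : E) : Prop :=
  forall u, (forall v, F u v e = 0) -> vat u (pi e) = cst 0.

(* The covariant exterior derivative in degree 1. *)
Definition dGamma (G : connection) (Q : form1) (u0 u1 : vfield B) : Cinf E :=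
  hor G u0 (Q u1) - hor G u1 (Q u0) - Q (lie_bracket u0 u1).

Definition bracket_wedge (P : bivector E) (Q : form1) (u0 u1 : vfield B) :
  Cinf E := P (Q u0) (Q u1) - P (Q u1) (Q u0).

(* P^natural of the annihilator of the vertical bundle. *)
Definition sharp_annihilator (P : bivector E) (e : E) : set (Cinf E -> R) :=
  [set vat (sharp P f) e | f in annihilates_vertical e].

Definition coupling_poisson (P : bivector E) : Prop :=
  poisson P /\ complementary_to_vertical (sharp_annihilator P).

(* Sections of Lambda^2 H, resp. Lambda^2 V. *)
Definition horizontal_bivector (G : connection) (P : bivector E) : Prop :=
  forall f e, hspace G e (vat (sharp P f) e).

Definition vertical_bivector (P : bivector E) : Prop :=
  forall f e, vertical e (vat (sharp P f) e).

(* P_H(b1, b2) = (pi^* F)(P_H^natural b1, P_H^natural b2), written at each point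
   [e] for b1 = d_e f1, b2 = d_e f2 in the annihilator of V_e, the horizontal
   vectors P_H^natural(b1), P_H^natural(b2) being the values at [e] of hor(u1)
   and hor(u2). *)
Definition coupling_form (G : connection) (PH : bivector E) (F : form2) : Prop :=
  (forall e, nondegenerate_at F e) /\
  forall e f1 f2 u1 u2,
    annihilates_vertical e f1 -> annihilates_vertical e f2 ->
    vat (sharp PH f1) e = vat (hor G u1) e ->
    vat (sharp PH f2) e = vat (hor G u2) e ->
    PH f1 f2 e = F u1 u2 e.

Definition geometric_data (P PV : bivector E) (G : connection) (F : form2) :
    Prop :=
  (forall e, hspace G e = sharp_annihilator P e) /\
  exists PH : bivector E,
    [/\ forall f g, P f g = PH f g + PV f g,
        horizontal_bivector G PH,
        vertical_bivector PV &
        coupling_form G PH F].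

End Bundle.

(* Main.v *)
Require Import Defs.
From mathcomp Require Import all_boot all_order all_algebra.
From mathcomp Require Import all_classical all_reals all_analysis.
From mathcomp Require Import ring lra.
Set Implicit Arguments.
Unset Strict Implicit.
Unset Printing Implicit Defensive.
Import Order.TTheory GRing.Theory Num.Theory.
Import numFieldNormedType.Exports.
Local Open Scope classical_set_scope.
Local Open Scope ring_scope.

(** Since the Hamiltonian field of [h_t] with respect to [Pi_t] preserves
    [Pi_t], it can be subtracted from the generator, which then becomes the
    horizontal field [X'_t = X_t - Pi_H^sharp dh_t].  Let [alpha_t] be the
    contraction of [F^t] with [X'_t], a one-form on the base with values in the
    functions on [E].  Around each point [X'_t] is the contraction of [Pi_t]
    with a one-form [- sum_k alpha_k dx_k], and the Jacobi identity gives
    [L_X' Pi] in terms of the differentials of the [alpha_k]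
    ([lie_derivative_frame]).  Reading [d Pi / dt = - L_X' Pi] on the geometric
    data yields the two infinitesimal equations
      [d hor^t(u) / dt = Upsilon^sharp d(alpha_t(u))]  ([hor_derivative]),
      [d F^t / dt = - partial^(Gamma^t) alpha_t]  ([F_derivative]).

    Set [Q^t = int_0^t alpha_s ds].  The first equation integrates to the
    required formula for [hor^t] in terms of [hor^0] and [Q^t].  Substituting
    that formula in the second equation turns the right-hand side into the time
    derivative of
    [- (partial^(Gamma^0) Q^t + 1/2 {Q^t /\ Q^t})], and both sides of the
    claimed formula agree at [t = 0].

    Three facts of analysis carry this argument.  A primitive in time of a
    smooth family of functions is smooth, and derivations in space commute with
    the integration ([smooth_family_primitive]).  A manifold has local frames
    made of global functions and global vector fields ([chart_frame]); this
    rests on bump functions and on Hadamard's lemma, and replaces computations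
    in coordinates.  Finally [alpha_t] is defined pointwise, and is smooth
    because it is so in each frame ([contraction_exists]). *)

(** * Partial derivatives within a set *)

Section Calculus.
Context {R : realType}.

Lemma is_derive_inP (V : lmodType R) (D : set V) (f : V -> R) x v l :
  is_derive_in D f x v l <->
  forall e, 0 < e -> \forall h \near (0 : R), h != 0 -> D (x + h *: v) ->
    `|h^-1 * (f (x + h *: v) - f x) - l| < e.
Proof.
rewrite /is_derive_in; split=> [/cvgrPdist_lt fl e e0|fl].
  have := fl e e0; rewrite near_withinE /dnbhs near_withinE.
  by apply: filterS => h hP h0 Dh; rewrite distrC; exact: hP.
apply/cvgrPdist_lt => e e0; rewrite near_withinE /dnbhs near_withinE.
by apply: filterS (fl e e0) => h hP h0 Dh; rewrite distrC; exact: hP.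
Qed.

Lemma near0_ball (P : R -> Prop) : (\forall h \near (0 : R), P h) ->
  exists2 d : R, 0 < d & forall h, `|h| < d -> P h.
Proof.
move=> /(nbhs_ballP (0 : R))[d /= d0 dP]; exists d => // h hd; apply: dP.
by rewrite /ball /= sub0r normrN.
Qed.

Lemma within_contP (T : topologicalType) (D : set T) (f : T -> R) :
  {within D, continuous f} <->
  forall x, D x -> forall e, 0 < e ->
    \forall y \near x, D y -> `|f y - f x| < e.
Proof.
rewrite subspace_continuousP; split=> H x Dx.
  move=> e e0; have /cvgrPdist_lt/(_ e e0) := H x Dx.
  rewrite near_withinE; apply: filterS => y + Dy.
  by rewrite distrC; apply.
apply/cvgrPdist_lt => e e0; rewrite near_withinE.
by apply: filterS (H x Dx e e0) => y + Dy; rewrite distrC; apply.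
Qed.

Lemma within_cont_comp (T S : topologicalType) (D : set T) (D' : set S)
    (g : T -> S) (f : S -> R) :
  {within D, continuous g} -> {within D', continuous f} ->
  (forall x, D x -> D' (g x)) -> {within D, continuous (f \o g)}.
Proof.
move=> /subspace_continuousP gc /subspace_continuousP fc gD.
apply/subspace_continuousP => x Dx A /(fc _ (gD _ Dx)) /= wA.
have /(gc x Dx) /= := wA.
rewrite /nbhs /= /within /=; apply: filterS => y + Dy.
by move=> /(_ Dy); apply; exact: gD.
Qed.

Lemma open_within (T S : topologicalType) (A : set T) (f : T -> S) (W : set S) :
  open A -> {within A, continuous f} -> open W -> open (A `&` f @^-1` W).
Proof.
move=> oA; rewrite continuous_open_subspace// => fA.
by move: W; apply/continuous_inP.
Qed.

Lemma is_derive_in_sub (V : lmodType R) (D D' : set V) (f : V -> R) x v l :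
  D' `<=` D -> is_derive_in D f x v l -> is_derive_in D' f x v l.
Proof.
move=> DD /is_derive_inP fl; apply/is_derive_inP => e e0.
by apply: filterS (fl e e0) => h + h0 /DD; exact.
Qed.

Lemma is_derive_in_ext (V : lmodType R) (D : set V) (f g : V -> R) x v l :
  D x -> (forall y, D y -> f y = g y) ->
  is_derive_in D f x v l -> is_derive_in D g x v l.
Proof.
move=> Dx fg /is_derive_inP fl; apply/is_derive_inP => e e0.
by apply: filterS (fl e e0) => h + h0 Dh; rewrite -!fg//; exact.
Qed.

Lemma is_derive_in_near (V : lmodType R) (D W : set V) (f : V -> R) x v l :
  (\forall h \near (0 : R), W (x + h *: v)) ->
  is_derive_in (D `&` W) f x v l -> is_derive_in D f x v l.
Proof.
move=> nW /is_derive_inP fl; apply/is_derive_inP => e e0.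
by apply: filterS2 nW (fl e e0) => h Wh + h0 Dh; apply.
Qed.

Lemma is_derive_in_sum (V : lmodType R) (D : set V) (I : Type) (r : seq I)
    (f : I -> V -> R) x v (l : I -> R) :
  (forall i, is_derive_in D (f i) x v (l i)) ->
  is_derive_in D (fun y => \sum_(i <- r) f i y) x v (\sum_(i <- r) l i).
Proof.
move=> fl; elim: r => [|i r IH].
  rewrite big_nil (_ : (fun y => _) = cst 0); first exact: is_derive_in_cst.
  by apply/funext => y; rewrite big_nil.
rewrite big_cons (_ : (fun y => _) = f i + (fun y => \sum_(i <- r) f i y)).
  exact: is_derive_inD.
by apply/funext => y; rewrite big_cons.
Qed.

Lemma is_derive_inZ (V : lmodType R) (D : set V) (f : V -> R) x v a l :
  is_derive_in D f x v l -> is_derive_in D (fun y => a * f y) x v (a * l).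
Proof.
move=> fl; have := is_derive_inM (is_derive_in_cst D a x v) fl.
by rewrite mul0r add0r; exact.
Qed.

Lemma is_derive_inN (V : lmodType R) (D : set V) (f : V -> R) x v l :
  is_derive_in D f x v l -> is_derive_in D (fun y => - f y) x v (- l).
Proof.
move=> fl; have := is_derive_inZ (a := -1) fl; rewrite mulN1r.
rewrite (_ : (fun y => _) = (fun y => - f y))//.
by apply/funext => y; rewrite mulN1r.
Qed.

Lemma is_derive_in_cont (V : lmodType R) (D : set V) (f : V -> R) x v l :
  is_derive_in D f x v l ->
  forall e, 0 < e -> \forall h \near (0 : R), D (x + h *: v) ->
    `|f (x + h *: v) - f x| < e.
Proof.
move=> /is_derive_inP /(_ _ ltr01) fl e e0.
have M0 : 0 < `|l| + 1 by rewrite ltr_wpDl.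
have dn : 0 < e / (`|l| + 1) by rewrite divr_gt0.
near=> h => Dh; have [->|h0] := eqVneq h 0.
  by rewrite scale0r addr0 subrr normr0.
have hl : `|h| < e / (`|l| + 1).
  by near: h; apply: (@nbhs0_lt R R).
rewrite -[X in `|X|](mulVKf h0) normrM.
have q1 : `|h^-1 * (f (x + h *: v) - f x) - l| < 1.
  by move: h0 Dh; near: h.
have q2 : `|h^-1 * (f (x + h *: v) - f x)| < `|l| + 1.
  rewrite -[X in `|X|](subrK l) addrC (le_lt_trans (ler_normD _ _)) //.
  by rewrite ltrD2l.
rewrite mulrC; apply: (@le_lt_trans _ _ ((`|l| + 1) * `|h|)).
  by rewrite ler_wpM2r// ltW.
by rewrite mulrC -ltr_pdivlMr.
Unshelve. all: by end_near. Qed.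

(** The condition under which partial derivatives within [D] are unique.  Open
    sets and products of the unit interval with an open set satisfy it. *)
Definition thick n (D : set 'rV[R]_n) := forall x, D x -> forall i e,
  0 < e -> exists h : R, [/\ h != 0, `|h| < e & D (x + h *: delta_mx 0 i)].

Lemma is_derive_in_unique (V : lmodType R) (D : set V) (f : V -> R) x v l l' :
  (forall e, 0 < e -> exists h : R, [/\ h != 0, `|h| < e & D (x + h *: v)]) ->
  is_derive_in D f x v l -> is_derive_in D f x v l' -> l = l'.
Proof.
move=> th /is_derive_inP fl /is_derive_inP fl'.
apply/eqP; rewrite -subr_eq0 -normr_le0; apply/ler_addgt0Pr => e e0.
rewrite add0r.
have e2 : 0 < e / 2 by rewrite divr_gt0.
have [d d0 dP] := near0_ball (fl _ e2).
have [d' d'0 d'P] := near0_ball (fl' _ e2).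
have [|h [h0 + Dh]] := th (Num.min d d'); first by rewrite lt_min d0.
rewrite lt_min => /andP[/dP/(_ h0 Dh) + /d'P/(_ h0 Dh)].
set X := h^-1 * _; move=> q q'.
rewrite (_ : l - l' = (X - l') - (X - l)); last by ring.
by rewrite (le_trans (ler_normB _ _))// (splitr e) lerD// ltW.
Qed.

Lemma Ck_on_sub n k (D D' : set 'rV[R]_n) f :
  D' `<=` D -> Ck_on k D f -> Ck_on k D' f.
Proof.
move=> DD; elim: k f => [|k IH] f [fc fd]; split=> //;
  try exact: continuous_subspaceW fc.
move=> i; have [g fg gk] := fd i; exists g; last exact: IH.
by move=> x /DD Dx; apply: is_derive_in_sub (fg x Dx).
Qed.

Lemma within_cont_ext (T : topologicalType) (D : set T) (f g : T -> R) :
  (forall x, D x -> f x = g x) ->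
  {within D, continuous f} -> {within D, continuous g}.
Proof.
by move=> fg; apply: subspace_eq_continuous => x /set_mem; exact: fg.
Qed.

Lemma Ck_on_ext n k (D : set 'rV[R]_n) f g :
  (forall x, D x -> f x = g x) -> Ck_on k D f -> Ck_on k D g.
Proof.
move=> fg; case: k => [|k] [fc fd]; split=> //; try exact: within_cont_ext fc.
move=> i; have [h fh hk] := fd i; exists h => // x Dx.
exact: is_derive_in_ext (fh x Dx).
Qed.

Lemma near_line n (W : set 'rV[R]_n) x v : open W -> W x ->
  \forall h \near (0 : R), W (x + h *: v).
Proof.
move=> oW Wx; have : {for (0 : R), continuous (fun h : R => x + h *: v)}.
  by apply: cvgD; [exact: cvg_cst|apply: cvgZr_tmp => //; exact: cvg_id].
by move=> /(_ W); rewrite /= scale0r addr0; apply; exact: open_nbhs_nbhs.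
Qed.

Lemma open_thick n (D : set 'rV[R]_n) : open D -> thick D.
Proof.
move=> oD x Dx i e e0.
have [d d0 dP] := near0_ball (near_line (delta_mx 0 i) oD Dx).
pose m := Num.min d e.
have m0 : 0 < m by rewrite lt_min d0.
exists (m / 2); have m2 : 0 < m / 2 by rewrite divr_gt0.
have mm : m / 2 < m by rewrite ltr_pdivrMr// ltr_pMr// ltr1n.
rewrite gt_eqF// gtr0_norm//; split=> //.
  by rewrite (lt_le_trans mm)// ge_min lexx orbT.
apply: dP; rewrite gtr0_norm// (lt_le_trans mm)//.
by rewrite ge_min lexx.
Qed.

(** Uniqueness of partial derivatives makes the local ones fit together. *)
Lemma Ck_on_local n k (D : set 'rV[R]_n) f : thick D ->
  (forall x, D x -> exists W, [/\ open W, W x & Ck_on k (D `&` W) f]) ->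
  Ck_on k D f.
Proof.
move=> tD; elim: k f => [|k IH] f fl.
  split=> //; apply/within_contP => x Dx e e0.
  have [W [oW Wx [/within_contP/(_ x (conj Dx Wx) e e0) fW _]]] := fl x Dx.
  near=> y => Dy; have : (D `&` W) y.
    by split=> //; near: y; exact: open_nbhs_nbhs.
  by near: y.
have {}fl x : D x -> exists W, [/\ open W, W x, {within D `&` W, continuous f} &
    forall i, exists2 g, forall y, (D `&` W) y ->
     is_derive_in D f y (delta_mx 0 i) (g y) & Ck_on k (D `&` W) g].
  move=> Dx; have [W [oW Wx [fc fd]]] := fl x Dx; exists W; split=> // i.
  have [g fg gk] := fd i; exists g => // y [Dy Wy].
  by apply: (is_derive_in_near (near_line _ oW Wy)); exact: fg.
split.
  apply: (Ck_on_continuous (k := k)); apply: IH => x Dx.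
  have [W [oW Wx fc fd]] := fl x Dx; exists W; split=> //.
  case: k {fl} fd => [|k] fd; split=> // i.
  have [g fg gk] := fd i; exists g; last exact: Ck_onS.
  by move=> y DWy; apply: is_derive_in_sub (fg y DWy) => z [].
move=> i.
pose g x := get [set l | is_derive_in D f x (delta_mx 0 i) l].
have gP x : D x -> is_derive_in D f x (delta_mx 0 i) (g x).
  move=> Dx; have [W [oW Wx fc /(_ i)[h fh hk]]] := fl x Dx.
  apply: (@getPex _ [set l | is_derive_in D f x (delta_mx 0 i) l]).
  by exists (h x); exact: fh.
exists g => //; apply: IH => x Dx.
have [W [oW Wx fc /(_ i)[h fh hk]]] := fl x Dx; exists W; split=> //.
apply: Ck_on_ext hk => y [Dy Wy].
by apply: (is_derive_in_unique (tD y Dy i) (fh y (conj Dy Wy))); exact: gP.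
Unshelve. all: by end_near. Qed.

Lemma Ck_on_partial n k (D : set 'rV[R]_n) f g i : thick D ->
  (forall x, D x -> is_derive_in D f x (delta_mx 0 i) (g x)) ->
  Ck_on k.+1 D f -> Ck_on k D g.
Proof.
move=> tD fg [_ /(_ i)[h fh hk]]; apply: Ck_on_ext hk => x Dx.
by apply: (is_derive_in_unique (tD x Dx i)); [exact: fh|exact: fg].
Qed.

Lemma smooth_on_partial n (D : set 'rV[R]_n) f i : thick D -> smooth_on D f ->
  exists2 g, forall x, D x -> is_derive_in D f x (delta_mx 0 i) (g x) &
    smooth_on D g.
Proof.
move=> tD fs; have [_ /(_ i)[g fg _]] := fs 1%N; exists g => // k.
exact: Ck_on_partial tD fg (fs k.+1).
Qed.

Lemma smooth_on_local n (D : set 'rV[R]_n) f : thick D ->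
  (forall x, D x -> exists W, [/\ open W, W x & smooth_on (D `&` W) f]) ->
  smooth_on D f.
Proof.
move=> tD fl k; apply: Ck_on_local => // x Dx.
by have [W [oW Wx fs]] := fl x Dx; exists W.
Qed.

Lemma smooth_on_ext n (D : set 'rV[R]_n) f g :
  (forall x, D x -> f x = g x) -> smooth_on D f -> smooth_on D g.
Proof. by move=> fg fs k; apply: Ck_on_ext (fs k). Qed.

Lemma smooth_on_sub n (D D' : set 'rV[R]_n) f :
  D' `<=` D -> smooth_on D f -> smooth_on D' f.
Proof. by move=> DD fs k; apply: Ck_on_sub (fs k). Qed.

Lemma smooth_onD n (D : set 'rV[R]_n) f g :
  smooth_on D f -> smooth_on D g -> smooth_on D (fun x => f x + g x).
Proof. by move=> fs gs k; exact: (Ck_onD (fs k) (gs k)). Qed.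

Lemma smooth_onM n (D : set 'rV[R]_n) f g :
  smooth_on D f -> smooth_on D g -> smooth_on D (fun x => f x * g x).
Proof. by move=> fs gs k; exact: (Ck_onM (fs k) (gs k)). Qed.

Lemma smooth_on_cst n (D : set 'rV[R]_n) a : smooth_on D (fun=> a).
Proof. by move=> k; exact: (@Ck_on_cst R n k D a). Qed.

Lemma smooth_on_sum n (D : set 'rV[R]_n) (I : Type) (r : seq I) (f : I -> _) :
  (forall i, smooth_on D (f i)) ->
  smooth_on D (fun x => \sum_(i <- r) f i x).
Proof.
move=> fs; elim: r => [|i r IH].
  by apply: smooth_on_ext (smooth_on_cst D 0) => x _; rewrite big_nil.
by apply: smooth_on_ext (smooth_onD (fs i) IH) => x _; rewrite big_cons.
Qed.

Lemma Ck_on_sum n k (D : set 'rV[R]_n) (I : Type) (r : seq I) (f : I -> _) :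
  (forall i, Ck_on k D (f i)) ->
  Ck_on k D (fun x => \sum_(i <- r) f i x).
Proof.
move=> fs; elim: r => [|i r IH].
  by apply: Ck_on_ext (Ck_on_cst k D 0) => x _; rewrite big_nil.
by apply: Ck_on_ext (Ck_onD (fs i) IH) => x _; rewrite big_cons.
Qed.

Lemma is_derive_in_coord n (D : set 'rV[R]_n) i x v :
  is_derive_in D (fun y => y 0 i) x v (v 0 i).
Proof.
apply/is_derive_inP => e e0; near=> h => h0 _.
by rewrite !mxE addrAC subrr add0r mulKf// subrr normr0.
Unshelve. all: by end_near. Qed.

Lemma within_cont_coord n (D : set 'rV[R]_n) i :
  {within D, continuous (fun y : 'rV[R]_n => y 0 i)}.
Proof. by apply: continuous_subspaceT; exact: coord_continuous. Qed.

Lemma smooth_on_coord n (D : set 'rV[R]_n) i : smooth_on D (fun y => y 0 i).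
Proof.
case=> [|k]; (split; first exact: within_cont_coord) => // j.
exists (cst ((delta_mx 0 j : 'rV[R]_n) 0 i)); last exact: Ck_on_cst.
by move=> x _; exact: is_derive_in_coord.
Qed.

End Calculus.

(** * Derivatives and primitives on the unit interval *)

Section UnitInterval.
Context {R : realType}.
Local Notation I01 := (unit_interval : set R^o).

Lemma is_derive_in_is_derive (D : set R^o) (f : R -> R) x l :
  (\forall h \near (0 : R), D (x + h)) -> is_derive_in D f x 1 l ->
  is_derive (x : R) 1 f l.
Proof.
move=> nD /is_derive_inP fl.
have c : (fun h : R => h^-1 *: ((f \o shift x) (h *: 1) - f x)) @ 0^' --> l.
  apply/cvgrPdist_lt => e e0; rewrite /dnbhs near_withinE.
  near=> h => h0; rewrite distrC /= [_ *: 1 + x]addrC; move: h0.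
  suff : h != 0 -> D (x + h *: 1) ->
      `|h^-1 * (f (x + h *: 1) - f x) - l| < e.
    move=> H h0; apply: H => //.
    by rewrite /GRing.scale /= mulr1; near: h.
  by near: h; exact: fl.
by apply: DeriveDef; [exact: cvgP c|exact: cvg_lim c].
Unshelve. all: by end_near. Qed.

Lemma MVT_in (D : set R^o) (f f' : R -> R) a b : a < b ->
  (forall x, a <= x <= b -> D x) ->
  (forall x, a <= x <= b -> is_derive_in D f x 1 (f' x)) ->
  exists2 c, a < c < b & f b - f a = f' c * (b - a).
Proof.
move=> ab abD fd.
have [x||c] := @MVT R f f' a b ab.
- rewrite in_itv /= => /andP[ax xb].
  apply: is_derive_in_is_derive (fd x _); last by rewrite !ltW.
  have d0 : 0 < Num.min (x - a) (b - x) by rewrite lt_min !subr_gt0 ax.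
  near=> h; have : `|h| < Num.min (x - a) (b - x).
    by near: h; apply: (@nbhs0_lt R R).
  by rewrite lt_min !ltr_norml => /andP[/andP[h1 h2] /andP[h3 h4]];
    apply: abD; apply/andP; split; lra.
- apply/within_contP => x; rewrite /= in_itv /= => xab e e0.
  have [d d0 dP] := near0_ball (is_derive_in_cont (fd x xab) e0).
  near=> y; rewrite /= in_itv /= => yab.
  have := dP (y - x); rewrite /GRing.scale /= mulr1 [x + _]addrC subrK; apply.
    rewrite distrC; suff : ball (x : R) d y by [].
    by near: y; exact: (@near_ball R R).
  exact: abD.
- by rewrite in_itv /= => cab e; exists c.
Unshelve. all: by end_near. Qed.

Lemma unit_interval_le t : 0 <= t <= 1 -> forall x : R, 0 <= x <= t -> I01 x.
Proof.
move=> /andP[t0 t1] x /andP[x0 xt].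
by rewrite /unit_interval /= x0 (le_trans xt).
Qed.

Lemma unit_interval_bound (f f' : R -> R) M :
  (forall t, I01 t -> is_derive_in I01 f t 1 (f' t)) ->
  (forall t, I01 t -> `|f' t| <= M) ->
  forall t, I01 t -> `|f t - f 0| <= M.
Proof.
move=> fd fM t t01; have /andP[t0 t1] := t01.
have M0 : 0 <= M by rewrite (le_trans _ (fM t t01)).
have [->|tn0] := eqVneq t 0; first by rewrite subrr normr0.
have [||x xt|c /andP[c0 ct] ->] := @MVT_in I01 f f' 0 t.
- by rewrite lt_neqAle eq_sym tn0.
- exact: unit_interval_le.
- exact/fd/(unit_interval_le t01).
have c01 : I01 c by apply: (unit_interval_le t01); rewrite !ltW.
rewrite subr0 normrM (ger0_norm t0) (le_trans (ler_pM _ _ (fM c c01) t1))//.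
by rewrite mulr1.
Qed.

(** All the identities between families depending on time are obtained from this
    uniqueness statement, by computing the derivatives of both sides. *)
Lemma unit_interval_eq (f g f' : R -> R) :
  (forall t, I01 t -> is_derive_in I01 f t 1 (f' t)) ->
  (forall t, I01 t -> is_derive_in I01 g t 1 (f' t)) ->
  f 0 = g 0 -> forall t, I01 t -> f t = g t.
Proof.
move=> fd gd fg0 t t01.
have : `|(f + (fun y => - g y)) t - (f + (fun y => - g y)) 0| <= 0.
  apply: (@unit_interval_bound _ (fun=> 0)) => // [s s01|s _].
    rewrite -(subrr (f' s)).
    by apply: is_derive_inD; [exact: fd|apply: is_derive_inN; exact: gd].
  by rewrite normr0.
by rewrite !fctE fg0 subrr subr0 normr_le0 subr_eq0 => /eqP.
Qed.

Lemma unit_interval_thick (t : R) : I01 t -> forall e, 0 < e ->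
  exists h : R, [/\ h != 0, `|h| < e & I01 (t + h *: (1 : R^o))].
Proof.
move=> /andP[t0 t1] e e0; pose m : R := Num.min (e / 2) (1 / 2).
have m0 : 0 < m by rewrite lt_min !divr_gt0.
have me : m < e.
  by rewrite (le_lt_trans (_ : _ <= e / 2)) ?ge_min ?lexx//; lra.
have m1 : m <= 1 / 2 by rewrite ge_min lexx orbT.
case: (ltP t (1 / 2)) => th.
  exists m; rewrite gt_eqF// gtr0_norm//; split=> //.
  by rewrite /GRing.scale /= mulr1 /unit_interval /=; apply/andP; split; lra.
exists (- m); rewrite oppr_eq0 gt_eqF// normrN gtr0_norm//; split=> //.
by rewrite /GRing.scale /= mulr1 /unit_interval /=; apply/andP; split; lra.
Qed.

Lemma unit_interval_unique (f : R -> R) t l l' : I01 t ->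
  is_derive_in I01 f t 1 l -> is_derive_in I01 f t 1 l' -> l = l'.
Proof. by move=> /unit_interval_thick; exact: is_derive_in_unique. Qed.

Lemma unit_interval_primitive (g : R -> R) :
  {within unit_interval, continuous g} ->
  exists G : R -> R, G 0 = 0 /\
    forall t, I01 t -> is_derive_in I01 G t 1 (g t).
Proof.
(* Extending [g] by constants and integrating from [-1] makes both end points
   interior, so that the fundamental theorem of calculus applies there. *)
move=> gc; pose clip (t : R) : R := Num.max 0 (Num.min t 1).
have clip01 t : I01 (clip t).
  rewrite /unit_interval /= /clip le_max lexx /= ge_max ler01 ge_min lexx.
  by rewrite orbT.
have clipE t : I01 t -> clip t = t.
  by move=> /andP[t0 t1]; rewrite /clip (min_idPl t1) (max_idPr t0).
have clip_cont : continuous clip.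
  have idc (x : R) : {for x, continuous (fun t : R => t)} by exact: cvg_id.
  have cc (a x : R) : {for x, continuous (fun _ : R => a)} by exact: cvg_cst.
  move=> x.
  exact: (continuous_max (cc 0 x) (continuous_min (idc x) (cc 1 x))).
have gclip : continuous (g \o clip).
  apply/continuous_subspace_setT.
  apply: (within_cont_comp (D' := unit_interval)) => //.
  exact: continuous_subspaceT.
pose mu := @lebesgue_measure R.
pose G x : R := (\int[mu]_(t in [set` `[-1, x]]) (g \o clip) t)%R.
have Gd t : I01 t -> derivable G t 1 /\ derive1 G t = g t.
  move=> t01; have /andP[t0 t1] := t01.
  rewrite -[in RHS](clipE t t01).
  apply: (@continuous_FTC1_closed R (g \o clip) (-1) t 2).
  - lra.
  - apply: continuous_compact_integrable; first exact: segment_compact.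
    exact: continuous_subspaceT.
  - lra.
  - exact: gclip.
exists (fun t => G t - G 0); split; first by rewrite subrr.
move=> t /Gd[Gt Gt'].
have : is_derive_in setT G (t : R^o) 1 (g t).
  rewrite -Gt' derive1E; apply/is_derive_inP => e e0.
  have /cvgrPdist_lt /(_ e e0) := Gt.
  rewrite /dnbhs near_withinE; apply: filterS => h + h0 _.
  by move=> /(_ h0); rewrite distrC /= [_ *: 1 + t]addrC.
move=> Gs; rewrite -[g t]addr0.
apply: is_derive_inD; last exact: is_derive_in_cst.
by apply: is_derive_in_sub Gs.
Unshelve. all: by end_near. Qed.

End UnitInterval.

(** * The chain rule *)

Section ChainRule.
Context {R : realType}.

Lemma is_derive_in_line n (U : set 'rV[R]_n) (F : 'rV[R]_n -> R) x v r l :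
  is_derive_in U F (x + r *: v) v l ->
  is_derive_in ([set s | U (x + s *: v)] : set R^o)
    (fun s => F (x + s *: v)) r 1 l.
Proof.
move=> /is_derive_inP Fl; apply/is_derive_inP => e e0.
apply: filterS (Fl e e0) => h + h0.
rewrite (_ : r + h *: _ = r + h); last by congr (_ + _); exact: mulr1.
by rewrite /= scalerDl addrA; exact.
Qed.

Lemma MVT_line n (U : set 'rV[R]_n) (F F' : 'rV[R]_n -> R) x v h :
  (forall r, `|r| <= `|h| -> U (x + r *: v)) ->
  (forall y, U y -> is_derive_in U F y v (F' y)) ->
  exists2 r, `|r| <= `|h| & F (x + h *: v) - F x = h * F' (x + r *: v).
Proof.
move=> Uh FF'; pose D := [set s : R^o | U (x + s *: v)].
have dF r : `|r| <= `|h| ->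
    is_derive_in D (fun s => F (x + s *: v)) r 1 (F' (x + r *: v)).
  by move=> rh; apply: is_derive_in_line; apply: FF'; exact: Uh.
case: (ltgtP h 0) => [h0|h0|->].
- have hb r : h <= r <= 0 -> `|r| <= `|h|.
    by move=> /andP[hr r0]; rewrite (ltr0_norm h0) (ler0_norm r0) lerN2.
  have [r /hb rh|r /hb/dF //|c /andP[hc c0]] := @MVT_in R D
      (fun s => F (x + s *: v)) (fun s => F' (x + s *: v)) h 0 h0.
    exact: Uh.
  rewrite scale0r addr0 sub0r => e; exists c; first by apply: hb; rewrite !ltW.
  by rewrite -[LHS]opprB e; ring.
- have hb r : 0 <= r <= h -> `|r| <= `|h|.
    by move=> /andP[hr r0]; rewrite (gtr0_norm h0) (ger0_norm hr).
  have [r /hb rh|r /hb/dF //|c /andP[hc c0]] := @MVT_in R D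
      (fun s => F (x + s *: v)) (fun s => F' (x + s *: v)) 0 h h0.
    exact: Uh.
  rewrite scale0r addr0 subr0 => e; exists c; first by apply: hb; rewrite !ltW.
  by rewrite e; ring.
- by exists 0; rewrite ?normr0// scale0r addr0 subrr mul0r.
Qed.

Lemma ball_rV n (x y : 'rV[R]_n) e : 0 < e ->
  (forall i, `|x 0 i - y 0 i| < e) -> ball x e y.
Proof. by move=> e0 xy; split=> // i j; rewrite ord1; exact: xy. Qed.

Lemma cvg_rV (T : Type) n (F : set_system T) (FF : Filter F)
    (g : T -> 'rV[R]_n) (x : 'rV[R]_n) :
  (forall i, (fun t => g t 0 i) @ F --> x 0 i) -> g @ F --> x.
Proof.
move=> gx; apply/cvg_ballP => e e0.
have : \forall t \near F, forall i, `|x 0 i - g t 0 i| < e.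
  by apply: filter_forall => i; have /cvgrPdist_lt /(_ e e0) := gx i.
by apply: filterS => t; exact: ball_rV.
Qed.

(** Caratheodory's form of differentiability, which reduces the chain rule to
    the limit of a finite sum of products.  The coefficients are the slopes of
    [F] along a path that changes one coordinate at a time; by the mean value
    theorem they tend to the partial derivatives. *)
Lemma caratheodory n (U : set 'rV[R]_n) (F : 'rV[R]_n -> R)
    (F' : 'I_n -> 'rV[R]_n -> R) x : open U -> U x ->
  (forall i y, U y -> is_derive_in U F y (delta_mx 0 i) (F' i y)) ->
  (forall i, {within U, continuous (F' i)}) ->
  exists phi : 'I_n -> 'rV[R]_n -> R,
    (forall i, phi i y @[y --> x] --> F' i x) /\
    (forall y, F y - F x = \sum_i phi i y * (y 0 i - x 0 i)).
Proof.
move=> oU Ux FF' F'c.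
pose p (y : 'rV[R]_n) (j : nat) : 'rV[R]_n :=
  \row_i (if (i < j)%N then y 0 i else x 0 i).
pose phi i (y : 'rV[R]_n) := if y 0 i == x 0 i then F' i x else
  (F (p y i.+1) - F (p y i)) / (y 0 i - x 0 i).
have pS y (i : 'I_n) : p y i.+1 = p y i + (y 0 i - x 0 i) *: delta_mx 0 i.
  apply/rowP => k; rewrite !mxE eqxx /= ltnS leq_eqVlt.
  have [->|ki] := eqVneq k i; first by rewrite eqxx ltnn /= mulr1 addrC subrK.
  by rewrite (inj_eq val_inj) (negbTE ki) mulr0 addr0.
have p0 y : p y 0 = x by apply/rowP => k; rewrite mxE.
have pn y : p y n = y by apply/rowP => k; rewrite mxE ltn_ord.
exists phi; split=> [i|y]; last first.
  transitivity (\sum_(0 <= j < n) (F (p y j.+1) - F (p y j))).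
    by rewrite telescope_sumr// pn p0.
  rewrite big_mkord; apply: eq_bigr => i _; rewrite /phi.
  case: eqVneq => [e|ne]; last by rewrite divfK// subr_eq0.
  by rewrite pS e subrr scale0r addr0 subrr mulr0.
apply/(@cvgrPdist_lt _ _ _ (nbhs x) (nbhs_filter x)) => e e0.
have /within_contP /(_ x Ux e e0) Fe := F'c i.
have : nbhs x (U `&` [set y | `|F' i y - F' i x| < e]).
  have nU : nbhs x U by exact: open_nbhs_nbhs.
  by apply: filterS2 nU Fe => y Uy Fy; split=> //; exact: Fy.
move=> /nbhs_ballP[d /= d0 dP]; near=> y.
have yd : ball x d y by near: y; exact: nbhsx_ballx.
rewrite distrC /phi; case: eqVneq => [_|ne]; first by rewrite subrr normr0.
have inb r : `|r| <= `|y 0 i - x 0 i| -> ball x d (p y i + r *: delta_mx 0 i).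
  move=> ry; apply: ball_rV => // k; have [_ /(_ 0 k)] := yd.
  rewrite /ball /= !mxE eqxx /=; have [->|ki] := eqVneq k i.
    rewrite ltnn mulr1 opprD addrA subrr sub0r normrN => yk.
    by rewrite (le_lt_trans ry)// distrC.
  by rewrite mulr0 addr0; case: ifP => // _ _; rewrite subrr normr0.
have [||r ry] := @MVT_line n (U `&` ball x d) F (F' i) (p y i) (delta_mx 0 i)
  (y 0 i - x 0 i).
- by move=> r /inb rb; split=> //; exact: (dP _ rb).1.
- by move=> z [Uz _]; apply: is_derive_in_sub (FF' i z Uz) => ? [].
rewrite -pS => ->; rewrite mulrC mulKf ?subr_eq0//.
exact: (dP _ (inb r ry)).2.
Unshelve. all: by end_near. Qed.

Lemma is_derive_in_comp (V : lmodType R) n (D : set V) (U : set 'rV[R]_n)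
    (g : V -> 'rV[R]_n) (F : 'rV[R]_n -> R)
    (F' : 'I_n -> 'rV[R]_n -> R) z v (l : 'I_n -> R) : open U ->
  (forall i y, U y -> is_derive_in U F y (delta_mx 0 i) (F' i y)) ->
  (forall i, {within U, continuous (F' i)}) ->
  U (g z) -> (forall i, is_derive_in D (fun y => g y 0 i) z v (l i)) ->
  is_derive_in D (F \o g) z v (\sum_i F' i (g z) * l i).
Proof.
move=> oU FF' F'c Ugz gl; have [phi [phic phiE]] := caratheodory oU Ugz FF' F'c.
rewrite /is_derive_in; set Fl := within _ _.
have FF : Filter Fl by exact: within_filter.
have gc : g (z + h *: v) @[h --> Fl] --> g z.
  apply: cvg_rV => i; apply/cvgrPdist_lt => e e0.
  rewrite /Fl near_withinE /dnbhs near_withinE.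
  by apply: filterS (is_derive_in_cont (gl i) e0) => h + _ Dh;
    rewrite distrC; exact.
rewrite (_ : (fun h : R => _) = (fun h : R => \sum_i phi i (g (z + h *: v)) *
    (h^-1 * (g (z + h *: v) 0 i - g z 0 i)))); last first.
  apply/funext => h; rewrite /= phiE mulr_sumr; apply: eq_bigr => i _.
  by rewrite mulrCA.
apply: cvg_big => //=.
  exact: add_continuous.
move=> i _; apply: cvgM; last exact: gl.
exact: (cvg_comp _ _ gc (phic i)).
Qed.

Lemma within_cont_rV m n (D : set 'rV[R]_m) (g : 'rV[R]_m -> 'rV[R]_n) :
  (forall i, {within D, continuous (fun y => g y 0 i)}) ->
  {within D, continuous g}.
Proof.
move=> gc; apply/subspace_continuousP => x Dx; apply: cvg_rV => i.
by have /subspace_continuousP := gc i; exact.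
Qed.

Lemma Ck_on_comp k m n (D : set 'rV[R]_m) (U : set 'rV[R]_n)
    (g : 'rV[R]_m -> 'rV[R]_n) (F : 'rV[R]_n -> R) : open U ->
  (forall z, D z -> U (g z)) -> (forall i, Ck_on k D (fun y => g y 0 i)) ->
  Ck_on k U F -> Ck_on k D (F \o g).
Proof.
move=> oU DU; elim: k F => [|k IH] F gk [Fc Fd].
  by split=> //; apply: within_cont_comp Fc DU; apply: within_cont_rV => i;
    exact: Ck_on_continuous (gk i).
split.
  by apply: within_cont_comp Fc DU; apply: within_cont_rV => i;
    exact: Ck_on_continuous (gk i).
pose F' i := s2val (cid2 (Fd i)).
have FF' i := s2valP (cid2 (Fd i)).
have F'k i : Ck_on k U (F' i) := s2valP' (cid2 (Fd i)).
move=> j.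
pose g' i := s2val (cid2 ((gk i).2 j)).
have gg' i := s2valP (cid2 ((gk i).2 j)).
have g'k i : Ck_on k D (g' i) := s2valP' (cid2 ((gk i).2 j)).
exists (fun z => \sum_i F' i (g z) * g' i z).
  move=> z Dz; apply: (is_derive_in_comp oU FF') => [i||i].
  - exact: Ck_on_continuous (F'k i).
  - exact: DU.
  - exact: gg'.
apply: Ck_on_sum => i; apply: (Ck_onM (f := F' i \o g)) => //.
by apply: IH => // i'; exact: Ck_onS.
Qed.

Lemma smooth_on_comp m n (D : set 'rV[R]_m) (U : set 'rV[R]_n)
    (g : 'rV[R]_m -> 'rV[R]_n) (F : 'rV[R]_n -> R) : open U ->
  (forall z, D z -> U (g z)) -> (forall i, smooth_on D (fun y => g y 0 i)) ->
  smooth_on U F -> smooth_on D (F \o g).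
Proof.
move=> oU DU gs Fs k; apply: (Ck_on_comp oU DU) (Fs k) => i; exact: gs.
Qed.

End ChainRule.

(** * Integration in time on the product of the unit interval and an open set *)

Section Slab.
Context {R : realType}.
Local Notation I01 := (unit_interval : set R^o).

(** The form taken in a chart by the domain of a smooth family. *)
Definition slab m (U : set 'rV[R]_m) : set 'rV[R]_(1 + m) :=
  [set z : 'rV[R]_(1 + m) | unit_interval (z 0 0) /\ U (rsubmx z)].

Definition slab_fun m (f : R -> 'rV[R]_m -> R) (z : 'rV[R]_(1 + m)) : R :=
  f (z 0 0) (rsubmx z).

Definition slab_point m (t : R) (x : 'rV[R]_m) : 'rV[R]_(1 + m) :=
  row_mx (const_mx t) x.

Lemma slab_point0 m t (x : 'rV[R]_m) : slab_point t x 0 0 = t.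
Proof.
transitivity (slab_point t x 0 (lshift m ord0)); last by rewrite row_mxEl mxE.
by congr (slab_point t x 0 _); exact: val_inj.
Qed.

Lemma slab_pointr m t (x : 'rV[R]_m) : rsubmx (slab_point t x) = x.
Proof. by rewrite row_mxKr. Qed.

Lemma slab_pointK m (z : 'rV[R]_(1 + m)) : slab_point (z 0 0) (rsubmx z) = z.
Proof.
rewrite -[RHS]hsubmxK; congr row_mx; apply/rowP => i; rewrite !mxE.
by congr (z 0 _); apply: val_inj => /=; case: i => [[]].
Qed.

Lemma slab_funE m (f : R -> 'rV[R]_m -> R) t x :
  slab_fun f (slab_point t x) = f t x.
Proof. by rewrite /slab_fun slab_point0 slab_pointr. Qed.

Lemma slabE m (U : set 'rV[R]_m) t x :
  slab U (slab_point t x) <-> unit_interval t /\ U x.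
Proof. by rewrite /slab /= slab_point0 slab_pointr. Qed.

Lemma slab_point_rshift m t (x : 'rV[R]_m) i :
  slab_point t x 0 (rshift 1 i) = x 0 i.
Proof. exact: row_mxEr. Qed.

Lemma slab_time m t (x : 'rV[R]_m) h :
  slab_point t x + h *: delta_mx 0 0 = slab_point (t + h) x.
Proof.
rewrite -[LHS]slab_pointK; congr slab_point.
  by rewrite mxE slab_point0 !mxE /= mulr1.
by apply/rowP => i; rewrite mxE mxE slab_point_rshift !mxE /= mulr0 addr0.
Qed.

Lemma slab_space m t (x : 'rV[R]_m) h i :
  slab_point t x + h *: delta_mx 0 (rshift 1 i) =
  slab_point t (x + h *: delta_mx 0 i).
Proof.
rewrite -[LHS]slab_pointK; congr slab_point.
  by rewrite mxE slab_point0 !mxE /= mulr0 addr0.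
apply/rowP => j; rewrite mxE mxE slab_point_rshift !mxE /=.
by rewrite (inj_eq (@rshift_inj 1 m)).
Qed.

Lemma slab_derive_time m (U : set 'rV[R]_m) (f : R -> 'rV[R]_m -> R) t x l :
  U x ->
  is_derive_in (slab U) (slab_fun f) (slab_point t x) (delta_mx 0 0) l <->
  is_derive_in I01 (f^~ x) t 1 l.
Proof.
move=> Ux; rewrite !is_derive_inP; split=> H e e0; apply: filterS (H e e0) => h;
  rewrite slab_time !slab_funE slabE (_ : t + h *: 1 = t + h) //;
  try (by congr (_ + _); exact: mulr1).
- by move=> + h0 th; apply.
- by move=> + h0 [th _]; apply.
Qed.

Lemma slab_derive_space m (U : set 'rV[R]_m) (f : R -> 'rV[R]_m -> R) t x i l :
  unit_interval t ->
  is_derive_in (slab U) (slab_fun f) (slab_point t x)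
    (delta_mx 0 (rshift 1 i)) l <->
  is_derive_in U (f t) x (delta_mx 0 i) l.
Proof.
move=> t01; rewrite !is_derive_inP; split=> H e e0;
  apply: filterS (H e e0) => h; rewrite slab_space !slab_funE slabE.
- by move=> + h0 th; apply.
- by move=> + h0 [_ th]; apply.
Qed.

Lemma slab_ordP m (P : 'I_(1 + m) -> Prop) :
  P 0 -> (forall i, P (rshift 1 i)) -> forall i, P i.
Proof.
move=> P0 Pr i; case: (split_ordP i) => j -> //.
by rewrite (_ : lshift m j = 0)//; apply: val_inj; case: j => [[]].
Qed.

Lemma slab_forall m (U : set 'rV[R]_m) (P : 'rV[R]_(1 + m) -> Prop) :
  (forall t x, unit_interval t -> U x -> P (slab_point t x)) ->
  forall z, slab U z -> P z.
Proof. by move=> H z [z0 Uz]; rewrite -[z]slab_pointK; exact: H. Qed.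

Lemma slab_thick m (U : set 'rV[R]_m) : open U -> thick (slab U).
Proof.
move=> oU; apply: slab_forall => t x t01 Ux; apply: slab_ordP => [|i] e e0.
  have [h [h0 he th]] := unit_interval_thick t01 e0.
  exists h; split=> //; rewrite slab_time slabE; split=> //.
  by rewrite -[h in t + h]mulr1.
have [h [h0 he th]] := open_thick oU Ux i e0.
by exists h; split=> //; rewrite slab_space slabE.
Qed.

Lemma slab_point_continuous m t : continuous (@slab_point m t).
Proof.
move=> x; apply: (@cvg_rV _ _ _ _ (nbhs_filter x)).
apply: slab_ordP => [|i].
  under eq_fun do rewrite slab_point0.
  by rewrite slab_point0; exact: cvg_cst.
under eq_fun do rewrite slab_point_rshift.
by rewrite slab_point_rshift; exact: coord_continuous.
Qed.

Lemma Ck_on_slice k m (U : set 'rV[R]_m) (F : 'rV[R]_(1 + m) -> R) t :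
  unit_interval t -> Ck_on k (slab U) F ->
  Ck_on k U (fun x => F (slab_point t x)).
Proof.
move=> t01; elim: k F => [|k IH] F [Fc Fd].
  split=> //; apply: (within_cont_comp (D' := slab U)) Fc _.
    by apply: continuous_subspaceT; exact: slab_point_continuous.
  by move=> x Ux; apply/slabE.
split.
  apply: (within_cont_comp (D' := slab U)) Fc _.
    by apply: continuous_subspaceT; exact: slab_point_continuous.
  by move=> x Ux; apply/slabE.
move=> i; have [g Fg gk] := Fd (rshift 1 i).
exists (fun x => g (slab_point t x)); last exact: IH.
move=> x Ux.
apply/(slab_derive_space U (fun s y => F (slab_point s y)) x i _ t01).
rewrite (_ : slab_fun _ = F); first by apply: Fg; apply/slabE.
by apply/funext => z; rewrite /slab_fun slab_pointK.
Qed.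

Lemma slab_near m t (x : 'rV[R]_m) (A : set 'rV[R]_(1 + m)) :
  nbhs (slab_point t x) A ->
  exists2 d : R, 0 < d & forall s y, `|t - s| < d -> ball x d y ->
    A (slab_point s y).
Proof.
move=> /nbhs_ballP[d /= d0 dA]; exists d => // s y ts xy; apply: dA.
apply: ball_rV => //; apply: slab_ordP => [|i]; first by rewrite !slab_point0.
by rewrite !slab_point_rshift; have [_ /(_ 0 i)] := xy.
Qed.

(** Compactness of the time interval makes continuity in space uniform in
    time. *)
Lemma slab_tube m (U : set 'rV[R]_m) (f : R -> 'rV[R]_m -> R) x e :
  {within slab U, continuous (slab_fun f)} -> U x -> 0 < e ->
  \forall y \near x, U y -> forall t, unit_interval t -> `|f t y - f t x| < e.
Proof.
move=> /within_contP fc Ux e0.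
have e2 : 0 < e / 2 by rewrite divr_gt0.
have cI : compact [set` `[(0 : R), 1]] by exact: segment_compact.
have /compact_near_coveringP H := cI.
have NF : Filter (nbhs x) := nbhs_filter x.
pose Q y t := U y -> unit_interval t -> `|f t y - f t x| < e.
have : \forall y \near x, [set` `[(0 : R), 1]] `<=` Q y.
  apply: (H _ (nbhs x) Q NF) => t; rewrite /= in_itv /= => t01.
  have /(fc _)/(_ _ e2) : slab U (slab_point t x) by apply/slabE.
  move=> /slab_near[d d0 dP].
  exists (ball t d, ball x d).
    by split; exact: nbhsx_ballx.
  move=> [s y] /= [ts xy] Uy s01.
  have := dP s y ts xy.
  rewrite slabE !slab_funE => /(_ (conj s01 Uy)) h1.
  have := dP s x ts (ballxx _ d0).
  rewrite slabE !slab_funE => /(_ (conj s01 Ux)) h2.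
  rewrite (_ : _ - _ = (f s y - f t x) - (f s x - f t x)); last by ring.
  by rewrite (le_lt_trans (ler_normB _ _))// (splitr e) ltrD.
by apply: filterS => y yP Uy t t01; apply: yP.
Qed.

Definition slab_primitive m (U : set 'rV[R]_m) (f G : R -> 'rV[R]_m -> R) :=
  forall x, U x -> G 0 x = 0 /\
    forall t, unit_interval t -> is_derive_in I01 (G^~ x) t 1 (f t x).

Lemma slab_primitive_exists m (U : set 'rV[R]_m) (f : R -> 'rV[R]_m -> R) :
  {within slab U, continuous (slab_fun f)} ->
  exists G, slab_primitive U f G.
Proof.
move=> /within_contP fc.
have H x : exists G : R -> R, U x -> G 0 = 0 /\
    forall t, unit_interval t -> is_derive_in I01 G t 1 (f t x).
  have [Ux|nUx] := pselect (U x); last by exists (fun=> 0).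
  have [|G GP] := @unit_interval_primitive R (f^~ x); last by exists G.
  apply/within_contP => t t01 e e0.
  have /(fc _)/(_ e e0) : slab U (slab_point t x) by apply/slabE.
  move=> /slab_near[d d0 dP]; near=> s => s01.
  have ts : ball (t : R) d s by near: s; exact: (@near_ball R R).
  by have := dP s x ts (ballxx _ d0); rewrite slabE !slab_funE; apply.
have [G GP] := choice H.
by exists (fun t x => G x t) => x /GP.
Unshelve. all: by end_near. Qed.

Lemma slab_primitive_cont m (U : set 'rV[R]_m) (f G : R -> 'rV[R]_m -> R) :
  open U -> {within slab U, continuous (slab_fun f)} -> slab_primitive U f G ->
  {within slab U, continuous (slab_fun G)}.
Proof.
move=> oU fc GP; apply/within_contP; apply: slab_forall => t x t01 Ux e e0.
have e2 : 0 < e / 2 by rewrite divr_gt0.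
have [d d0 dP] := near0_ball (is_derive_in_cont ((GP x Ux).2 t t01) e2).
have tube : nbhs x _ := slab_tube fc Ux e2.
have /nbhs_ballP[d' /= d'0 d'P] := tube.
near=> z => -[z01 Uz]; rewrite -[z]slab_pointK !slab_funE.
have zb : ball (slab_point t x) (Num.min d d') z.
  by near: z; apply: nbhsx_ballx; rewrite lt_min d0.
move: z01 Uz; set s := z 0 0; set y := rsubmx z => s01 Uy.
have ts : `|s - t| < d.
  have := zb.2 0 0; rewrite slab_point0 /ball /= distrC.
  by rewrite lt_min => /andP[].
have xy : ball x d' y.
  apply: ball_rV => // i; have := zb.2 0 (rshift 1 i).
  by rewrite slab_point_rshift /ball /= lt_min /y mxE => /andP[].
rewrite (_ : _ - _ = (G s y - G s x) + (G s x - G t x)); last by ring.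
rewrite (le_lt_trans (ler_normD _ _))// (splitr e) ler_ltD//; last first.
  have := dP (s - t) ts; rewrite (_ : t + (s - t) *: 1 = s); first exact.
  by rewrite -[RHS](subrK t) addrC; congr (_ + _); exact: mulr1.
have [[Gx0 Gx] [Gy0 Gy]] := (GP x Ux, GP y Uy).
have -> : G s y - G s x = (G s y - G s x) - (G 0 y - G 0 x).
  by rewrite Gx0 Gy0 !subr0.
apply: (@unit_interval_bound R (fun r => G r y - G r x)
  (fun r => f r y - f r x)) => // r r01.
  by apply: is_derive_inD; [exact: Gy|apply: is_derive_inN; exact: Gx].
by rewrite ltW// (d'P y xy).
Unshelve. all: by end_near. Qed.

(** Differentiation under the integral sign.  The error made in replacing [G']
    by a difference quotient of [G] is itself a primitive in time, of a function
    that is uniformly small by the mean value theorem and [slab_tube]. *)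
Lemma slab_primitive_partial m (U : set 'rV[R]_m)
    (f g G G' : R -> 'rV[R]_m -> R) i : open U ->
  {within slab U, continuous (slab_fun g)} ->
  (forall t x, unit_interval t -> U x ->
    is_derive_in U (f t) x (delta_mx 0 i) (g t x)) ->
  slab_primitive U f G -> slab_primitive U g G' ->
  forall t x, unit_interval t -> U x ->
    is_derive_in U (G t) x (delta_mx 0 i) (G' t x).
Proof.
move=> oU gc fg GP G'P t x t01 Ux; apply/is_derive_inP => e e0.
have e2 : 0 < e / 2 by rewrite divr_gt0.
have [d d0 dP] : exists2 d : R, 0 < d & forall y, ball x d y -> U y /\
    (U y -> forall r, unit_interval r -> `|g r y - g r x| < e / 2).
  have [|d /= d0 dP] := (nbhs_ballP x (U `&` [set y | U y ->
      forall r, unit_interval r -> `|g r y - g r x| < e / 2])).1.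
    apply: filterI; first exact: open_nbhs_nbhs.
    exact: slab_tube gc Ux e2.
  by exists d.
near=> h => h0 Uh.
have hd : `|h| < d by near: h; exact: (@nbhs0_lt R R).
have rb r : `|r| <= `|h| -> ball x d (x + r *: delta_mx 0 i).
  move=> rh; apply: ball_rV => // k.
  rewrite !mxE opprD addrA subrr sub0r normrN.
  rewrite normrM (le_lt_trans _ hd)// -[leRHS]mulr1 ler_pM//.
  by rewrite normr_nat; case: (_ && _).
set y := x + h *: _.
have Uy : U y by exact: (dP _ (rb h (lexx _))).1.
have [[Gx0 Gx] [Gy0 Gy]] := (GP x Ux, GP y Uy).
have [G'x0 G'x] := G'P x Ux.
pose k r := h^-1 * (G r y - G r x) - G' r x.
rewrite -[X in `|X|]/(k t) -[k t]subr0.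
have <- : k 0 = 0 by rewrite /k Gx0 Gy0 G'x0 !subr0 mulr0.
apply: (@le_lt_trans _ _ (e / 2)); last first.
  by rewrite ltr_pdivrMr// ltr_pMr// ltr1n.
apply: (@unit_interval_bound R k
  (fun r => h^-1 * (f r y - f r x) - g r x)) => // r r01.
  apply: is_derive_inD; last by apply: is_derive_inN; exact: G'x.
  apply: is_derive_inZ.
  by apply: is_derive_inD; [exact: Gy|apply: is_derive_inN; exact: Gx].
have [s /rb/dP[]||s /rb/dP[Us +] ->] :=
  @MVT_line R m U (f r) (g r) x (delta_mx 0 i) h.
- by [].
- by move=> z Uz; exact: fg.
by rewrite mulKf// => /(_ Us r r01) /ltW.
Unshelve. all: by end_near. Qed.

(** By induction on the order of differentiability: the derivative in time of
    [G] is [f], and its derivatives in space are primitives of those of [f]. *)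
Lemma slab_primitive_smooth m (U : set 'rV[R]_m) (f G : R -> 'rV[R]_m -> R) :
  open U -> smooth_on (slab U) (slab_fun f) -> slab_primitive U f G ->
  smooth_on (slab U) (slab_fun G).
Proof.
move=> oU fs GP k.
elim: k f G fs GP => [|k IH] f G fs GP; have fc := Ck_on_continuous (fs 0%N).
  by split=> //; exact: slab_primitive_cont GP.
split; first exact: slab_primitive_cont GP.
apply: slab_ordP => [|i].
  exists (slab_fun f); last exact: fs.
  apply: slab_forall => t x t01 Ux; rewrite slab_funE slab_derive_time//.
  exact: (GP x Ux).2.
have [g' fg' gs] := smooth_on_partial (rshift 1 i) (slab_thick oU) fs.
pose g t x := g' (slab_point t x).
have gE : slab_fun g = g'.
  by apply/funext => z; rewrite /slab_fun /g slab_pointK.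
have {}gs : smooth_on (slab U) (slab_fun g) by rewrite gE.
have gc := Ck_on_continuous (gs 0%N).
have [G' G'P] := slab_primitive_exists gc.
exists (slab_fun G'); last exact: IH G'P.
apply: slab_forall => t x t01 Ux; rewrite slab_funE slab_derive_space//.
apply: (slab_primitive_partial oU gc _ GP G'P) => // s y s01 Uy.
by apply/(slab_derive_space U f y i _ s01); apply: fg'; apply/slabE.
Qed.

Lemma smooth_on_slab_local m (U : set 'rV[R]_m) F : open U ->
  (forall x, U x -> exists V, [/\ open V, V x & smooth_on (slab V) F]) ->
  smooth_on (slab U) F.
Proof.
move=> oU H; apply: smooth_on_local; first exact: slab_thick.
move=> z [z0 zU]; have [V [oV Vz Fs]] := H _ zU.
exists [set z | V (rsubmx z)]; split=> //.
  apply: open_comp => // y _; apply: (@cvg_rV _ _ _ _ (nbhs_filter y)) => i.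
  under eq_fun do rewrite mxE.
  by rewrite mxE; exact: coord_continuous.
by apply: smooth_on_sub Fs => y [[]].
Qed.

End Slab.

(** * Hadamard's lemma *)

Section Hadamard.
Context {R : realType}.

Lemma is_derive_in_id (D : set R^o) (t a : R) :
  is_derive_in D (fun s : R^o => s * a) t 1 a.
Proof.
apply/is_derive_inP => e e0; near=> h => h0 _.
rewrite (_ : t + h *: _ = t + h); last by congr (_ + _); exact: mulr1.
by rewrite mulrDl addrAC subrr add0r mulKf// subrr normr0.
Unshelve. all: by end_near. Qed.

(** The factors [G i] are the means of the partial derivatives of [F] along the
    segments from [x], hence the restriction to a ball inside [U]. *)
Lemma hadamard n (U : set 'rV[R]_n) (F : 'rV[R]_n -> R) x : open U -> U x ->
  smooth_on U F -> exists V (G : 'I_n -> 'rV[R]_n -> R),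
    [/\ open V, V x, V `<=` U, forall i, smooth_on V (G i) &
     (forall y, V y -> F y = F x + \sum_i (y 0 i - x 0 i) * G i y) /\
     (forall i, is_derive_in U F x (delta_mx 0 i) (G i x))].
Proof.
move=> oU Ux Fs.
have /nbhs_ballP[r /= r0 rU] := open_nbhs_nbhs (conj oU Ux).
have oV : open (ball x r) by exact: ball_open.
have Vx : ball x r x by exact: ballxx.
pose l t y : 'rV[R]_n := x + t *: (y - x).
have lV t y : unit_interval t -> ball x r y -> ball x r (l t y).
  move=> /andP[t0 t1] [_ xy]; apply: ball_rV => // i; rewrite !mxE.
  rewrite opprD addrA subrr sub0r normrN normrM ger0_norm// distrC.
  by rewrite (le_lt_trans _ (xy 0 i))// ler_piMl.
pose g i := s2val (cid2 (smooth_on_partial i (open_thick oU) Fs)).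
have Fg i y : U y -> is_derive_in U F y (delta_mx 0 i) (g i y).
  exact: (s2valP (cid2 (smooth_on_partial i (open_thick oU) Fs))).
have gs i : smooth_on U (g i).
  exact: (s2valP' (cid2 (smooth_on_partial i (open_thick oU) Fs))).
have phis i : smooth_on (slab (ball x r)) (slab_fun (fun t y => g i (l t y))).
  apply: (smooth_on_comp (U := U) (F := g i)
    (g := fun z : 'rV[R]_(1 + n) => l (z 0 0) (rsubmx z))) => //.
    by move=> z [z0 zx]; apply: rU; exact: lV.
  move=> j; rewrite (_ : (fun z => _) = (fun z : 'rV[R]_(1 + n) =>
      x 0 j + z 0 0 * (z 0 (rshift 1 j) + - x 0 j))).
    apply: smooth_onD; first exact: smooth_on_cst.
    apply: smooth_onM; first exact: smooth_on_coord.
    by apply: smooth_onD; [exact: smooth_on_coord|exact: smooth_on_cst].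
  by apply/funext => z; rewrite !mxE.
pose G i := sval (cid (slab_primitive_exists (Ck_on_continuous (phis i 0%N)))).
have GP i : slab_primitive (ball x r) (fun t y => g i (l t y)) (G i).
  exact: (svalP (cid (slab_primitive_exists (Ck_on_continuous (phis i 0%N))))).
have I1 : unit_interval (1 : R) by rewrite /unit_interval /= ler01 lexx.
exists (ball x r), (fun i => G i 1); split=> //.
  move=> i k; have Gs := slab_primitive_smooth oV (phis i) (GP i).
  apply: Ck_on_ext (Ck_on_slice I1 (Gs k)) => y _.
  by rewrite slab_funE.
split=> [y Vy|i]; last first.
  rewrite (_ : G i 1 x = 1 * g i x); first by rewrite mul1r; exact: Fg.
  have [G0 Gd] := GP i x Vx.
  apply: (unit_interval_eq (f := (G i)^~ x) (g := fun t => t * g i x)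
    (f' := fun=> g i x)) => // [t t01|t t01|].
  - by have := Gd t t01; rewrite /l subrr scaler0 addr0.
  - exact: is_derive_in_id.
  - by rewrite G0 mul0r.
have lE : l 1 y = y by rewrite /l scale1r addrC subrK.
apply/eqP; rewrite addrC -subr_eq -{1}lE; apply/eqP.
apply: (unit_interval_eq (f := fun t => F (l t y) + - F x)
  (g := fun t => \sum_i (y 0 i - x 0 i) * G i t y)
  (f' := fun t => \sum_i (y 0 i - x 0 i) * g i (l t y))) => // [t t01|t t01|].
- rewrite -[X in is_derive_in _ _ _ _ X]addr0.
  apply: is_derive_inD; last exact: is_derive_in_cst.
  rewrite (eq_bigr (fun i => g i (l t y) * (y 0 i - x 0 i))); last first.
    by move=> i _; rewrite mulrC.
  apply: (is_derive_in_comp (U := U) (F := F)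
    (g := fun t : R^o => l t y)) => //.
  - by move=> i; exact: Ck_on_continuous (gs i 0%N).
  - by apply: rU; exact: lV.
  move=> i; rewrite (_ : (fun t => _) =
    (cst (x 0 i) + (fun s : R^o => s * (y 0 i - x 0 i)))).
    rewrite -[X in is_derive_in _ _ _ _ X]add0r.
    by apply: is_derive_inD; [exact: is_derive_in_cst|exact: is_derive_in_id].
  by apply/funext => s; rewrite /l !mxE.
- apply: is_derive_in_sum => i; apply: is_derive_inZ.
  exact: (GP i y Vy).2.
- rewrite /l scale0r addr0 subrr big1// => i _.
  by rewrite (GP i y Vy).1 mulr0.
Qed.

End Hadamard.

(** * Bump functions *)

Section Bump.
Context {R : realType}.

(** All the exponents [k] are treated together because the derivative of each
    [flat k] is a combination of [flat k.+1] and [flat k.+2]. *)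
Definition flat (k : nat) (t : R) : R :=
  if 0 < t then t^-1 ^+ k * expR (- t^-1) else 0.

(** From the term of order [k + 1] of the exponential series; applied to
    [k + 1] it shows that [flat k] has derivative zero at the origin. *)
Lemma flat_bound k t : 0 <= flat k t <= k.+1`!%:R * `|t|.
Proof.
rewrite /flat; case: ifPn => t0; last first.
  by rewrite lexx mulr_ge0// ler0n.
have ti0 : 0 < t^-1 by rewrite invr_gt0.
apply/andP; split; first by rewrite mulr_ge0 ?exprn_ge0 ?expR_ge0 ?ltW.
rewrite gtr0_norm// expRN.
have := expR_ge1Dxn k (ltW ti0); set N := _%:R => le1.
have N0 : 0 < N by rewrite ltr0n fact_gt0.
have le2 : t^-1 ^+ k.+1 <= N * expR t^-1.
  by rewrite -ler_pdivrMl// mulrC; lra.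
rewrite ler_pdivrMr ?expR_gt0// -(ler_pM2l ti0) -exprS.
by rewrite (le_trans le2)// mulrA [t^-1 * _]mulrCA mulVf ?mulr1// gt_eqF.
Qed.

Lemma flat_is_derive k (t : R) :
  is_derive t 1 (flat k) (flat k.+2 t - k%:R * flat k.+1 t).
Proof.
have [t0|t0|->] := ltgtP t 0.
- have flat0 j s : s <= 0 -> flat j s = 0 by rewrite /flat ltNge => ->.
  rewrite !flat0 ?ltW// mulr0 subr0.
  apply: (@near_eq_is_derive _ _ _ (cst 0)).
  near=> s; rewrite flat0//= ltW//; near: s; exact: lt_nbhsl.
- have -> : flat k.+2 t - k%:R * flat k.+1 t =
      t^-1 ^+ k *: (expR (- t^-1) * - (- t ^- 2 *: 1)) +
      expR (- t^-1) *: ((k%:R * t^-1 ^+ k.-1) *: (- t ^- 2 *: 1)).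
    rewrite /flat t0 /GRing.scale /= !mulr1 -exprVn; case: k => [|k].
      by rewrite !mul0r mulr0 subr0 addr0 mul1r opprK mulrC expr2.
    by rewrite /= !exprS; ring.
  apply: (@near_eq_is_derive _ _ _ ((fun s : R => s^-1) ^+ k *
      (expR \o (fun s : R => - s^-1)))).
    near=> s; rewrite /flat !fctE /= ifT//.
    by near: s; exact: lt_nbhsr.
  have dV : is_derive t 1 (fun s : R => s^-1) (- t ^- 2 *: 1).
    by apply: is_deriveV; rewrite gt_eqF.
  have dE : is_derive t 1 (expR \o (fun s : R => - s^-1))
      (expR (- t^-1) * - (- t ^- 2 *: 1)).
    by apply: is_derive1_comp; exact: is_deriveN dV.
  have dX := is_deriveX k dV.
  by apply: (is_derive_eq (is_deriveM dX dE)); rewrite exprfctE.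
have flat00 j : flat j (0 : R) = 0 by rewrite /flat ltxx.
rewrite !flat00 mulr0 subr0.
have c : (fun h : R => h^-1 *: ((flat k \o shift 0) (h *: 1) - flat k 0)) @ 0^'
    --> (0 : R).
  apply/cvgrPdist_lt => e e0; rewrite /dnbhs near_withinE.
  have d0 : 0 < e / k.+2`!%:R by rewrite divr_gt0// ltr0n fact_gt0.
  near=> h => h0.
  have hd : `|h| < e / k.+2`!%:R by near: h; exact: (@nbhs0_lt R R).
  rewrite sub0r normrN /= addr0 flat00 subr0.
  rewrite (_ : h *: 1 = h); last exact: mulr1.
  have -> : h^-1 *: flat k h = flat k.+1 h.
    rewrite /GRing.scale /= /flat; case: ifP => _; last by rewrite mulr0.
    by rewrite exprS mulrA.
  have /andP[f0 f1] := flat_bound k.+1 h.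
  by rewrite ger0_norm// (le_lt_trans f1)// mulrC -ltr_pdivlMr ?ltr0n ?fact_gt0.
by apply: DeriveDef; [exact: cvgP c|exact: cvg_lim c].
Unshelve. all: by end_near. Qed.

Lemma smooth_on_flat n k (D : set 'rV[R]_n) u :
  smooth_on D u -> smooth_on D (fun z => flat k (u z)).
Proof.
move=> us; pose F k (y : 'rV[R]_1) := flat k (y 0 0).
have Fs : smooth_on setT (F k).
  have Fd j y : is_derive_in setT (F j) y (delta_mx 0 0)
      (F j.+2 y + - j%:R * F j.+1 y).
    have [/cvgrPdist_lt fl flE] := flat_is_derive j (y 0 0).
    apply/is_derive_inP => e e0; have := fl e e0.
    rewrite /dnbhs near_withinE; apply: filterS => h + h0 _.
    move=> /(_ h0); rewrite distrC -[lim _]/('D_1 (flat j) (y 0 0)) flE.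
    rewrite /F /= !mxE mulNr addrC.
    by rewrite [h *: 1 + _]addrC.
  move=> r; elim: r k => [|r IH] k'.
    split=> //; apply/within_contP => y _ e e0.
    have : {for y 0 0, continuous (flat k')}.
      have [dfl _] := flat_is_derive k' (y 0 0).
      by apply/differentiable_continuous/derivable1_diffP.
    move=> /cvgrPdist_lt /(_ e e0) cf.
    have cf' : \forall z \near (y : 'rV[R]_1),
        `|flat k' (y 0 0) - flat k' ((z : 'rV[R]_1) 0 0)| < e.
      exact: (@coord_continuous R 1 1 0 0 y _ cf).
    by apply: filterS cf' => z + _; rewrite distrC.
  split; first exact: Ck_on_continuous (IH k').
  move=> i; rewrite ord1; exists (F k'.+2 + cst (- k'%:R) * F k'.+1).
    by move=> y _; exact: Fd.
  by apply: Ck_onD => //; apply: Ck_onM => //; exact: Ck_on_cst.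
rewrite (_ : (fun z => _) = F k \o (fun z => const_mx (u z))).
  apply: (smooth_on_comp (U := setT)) => //; first exact: openT.
  by move=> i; apply: smooth_on_ext us => z _; rewrite mxE.
by apply/funext => z; rewrite /F /= mxE.
Qed.

(** The bump is [flat 0 (c - flat 0 u) / flat 0 c], where [u] is an affine
    function of the squared distance to [p] and [c = flat 0 1].  If [u <= 0],
    the inner function vanishes and the quotient is [1]; if [1 <= u], the
    argument of the outer function is nonpositive. *)
Lemma bump_rV n (p : 'rV[R]_n) r : 0 < r ->
  exists beta : 'rV[R]_n -> R, exists K : set 'rV[R]_n,
    [/\ smooth_on setT beta, \forall y \near p, beta y = 1,
        compact K, K `<=` ball p r & forall y, ~ K y -> beta y = 0].
Proof.
move=> r0.
pose Q (y : 'rV[R]_n) := \sum_i (y 0 i - p 0 i) * (y 0 i - p 0 i).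
have Qs : smooth_on setT Q.
  apply: smooth_on_sum => i; apply: smooth_onM; apply: smooth_onD;
    (try exact: smooth_on_coord); exact: smooth_on_cst.
pose c : R := flat 0 1.
have c0 : 0 < c by rewrite /c /flat ltr01 expr0 mul1r expR_gt0.
have fc0 : 0 < flat 0 c by rewrite /flat c0 expr0 mul1r expR_gt0.
(* [u <= 0] when [Q <= r ^+ 2 / 8], and [1 <= u] when [r ^+ 2 / 4 <= Q], thus
   outside the cube of half-side [r / 2]. *)
pose u y := 8 / r ^+ 2 * Q y + -1.
pose beta y := (flat 0 c)^-1 * flat 0 (c + -1 * flat 0 (u y)).
have r2 : 0 < r ^+ 2 by rewrite exprn_gt0.
exists beta,
  [set y | forall i, `[p 0 i - r / 2, p 0 i + r / 2]%classic (y 0 i)].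
split.
- apply: smooth_onM; first exact: smooth_on_cst.
  apply: smooth_on_flat; apply: smooth_onD; first exact: smooth_on_cst.
  apply: smooth_onM; first exact: smooth_on_cst.
  apply: smooth_on_flat; apply: smooth_onD; last exact: smooth_on_cst.
  by apply: smooth_onM => //; exact: smooth_on_cst.
- have Qc : {within setT, continuous Q} := Ck_on_continuous (Qs 0%N).
  have e0 : 0 < r ^+ 2 / 8 by rewrite divr_gt0.
  move/within_contP : Qc => /(_ p I _ e0); apply: filterS => y /(_ I).
  have -> : Q p = 0 by apply: big1 => i _; rewrite subrr mulr0.
  rewrite subr0 => Qy; rewrite /beta [flat 0 (u y)](_ : _ = 0).
    by rewrite mulr0 addr0 mulVf// gt_eqF.
  rewrite /flat ifF//; apply/negbTE; rewrite -leNgt /u subr_le0.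
  have Qle : Q y <= r ^+ 2 / 8 by rewrite (le_trans (ler_norm _))// ltW.
  have k0 : 0 <= 8 / r ^+ 2 by rewrite ltW// divr_gt0.
  rewrite (le_trans (ler_wpM2l k0 Qle))//.
  suff -> : 8 / r ^+ 2 * (r ^+ 2 / 8) = 1 by rewrite lexx.
  by field; rewrite gt_eqF.
- apply: (@rV_compact R n (fun i => `[p 0 i - r / 2, p 0 i + r / 2]%classic)).
  by move=> i; exact: segment_compact.
- move=> y yK; apply: ball_rV => // i; have := yK i; rewrite /= in_itv /=.
  by move=> /andP[h1 h2]; rewrite ltr_norml; apply/andP; split; lra.
move=> y yK.
have [i yi] : exists i, ~ `[p 0 i - r / 2, p 0 i + r / 2]%classic (y 0 i).
  by apply/existsNP.
have u1 : 1 <= u y.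
  rewrite /u -lerBlDr opprK -ler_pdivrMl ?divr_gt0// invf_div.
  have -> : r ^+ 2 / 8 * (1 + 1) = (r / 2) * (r / 2) by field.
  rewrite /Q (bigD1 i)//= -[leLHS]addr0 lerD//; last first.
    by apply: sumr_ge0 => j _; rewrite -expr2 sqr_ge0.
  move: yi; rewrite /= in_itv /= => /negP.
  by rewrite negb_and -!ltNge => /orP[h|h]; nra.
have u0 : 0 < u y by rewrite (lt_le_trans ltr01).
have cu : c <= flat 0 (u y).
  rewrite /c /flat ltr01 u0 !expr0 !mul1r ler_expR lerN2 invr1.
  by rewrite invf_le1.
rewrite /beta [flat 0 (c + _)](_ : _ = 0) ?mulr0// {1}/flat ifF//.
by apply/negbTE; rewrite -leNgt mulN1r subr_le0.
Qed.

(** Outside [K], which is closed, the product vanishes whatever the values of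
    [g]. *)
Lemma cutoff_smooth n (V K : set 'rV[R]_n) (beta g : 'rV[R]_n -> R) :
  open V -> compact K -> K `<=` V -> smooth_on setT beta ->
  (forall y, ~ K y -> beta y = 0) -> smooth_on V g ->
  smooth_on setT (fun y => beta y * g y).
Proof.
move=> oV cK KV bs bK gs.
apply: smooth_on_local => [|y _]; first by apply: open_thick; exact: openT.
have Kcl : closed K.
  by apply: compact_closed => //; exact: norm_hausdorff.
have [Vy|nVy] := pselect (V y).
  exists V; split=> //; rewrite setTI; apply: smooth_onM => //.
  exact: smooth_on_sub bs.
exists (~` K); split; first by rewrite openC.
  by move=> /KV.
rewrite setTI; apply: (smooth_on_ext (f := fun=> 0)); last exact: smooth_on_cst.
by move=> z Kz; rewrite bK// mul0r.
Qed.

End Bump.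

(** * Smooth functions on a manifold *)

Section Charts.
Context {R : realType} {M : manifold R}.
Implicit Types (c : chart R M (mdim M)) (p q : M).

Lemma cimg_cinv c y : cimg c y -> cdom c (cinv c y) /\ cmap c (cinv c y) = y.
Proof. by move=> [q cq <-]; rewrite cmapK. Qed.

Lemma cimg_cmap c q : cdom c q -> cimg c (cmap c q).
Proof. by move=> cq; exists q. Qed.

Lemma chart_imageE c (W : set M) :
  cmap c @` (cdom c `&` W) = cimg c `&` cinv c @^-1` W.
Proof.
apply/seteqP; split=> [y [q [cq Wq] <-]|y [/cimg_cinv[cq yE] Wq]].
  by split; [exact: cimg_cmap|rewrite /= cmapK].
by exists (cinv c y).
Qed.

Lemma open_chart_image c (W : set M) :
  open W -> open (cmap c @` (cdom c `&` W)).
Proof.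
move=> oW; rewrite chart_imageE; apply: open_within => //.
  exact: cimg_open.
exact: cinv_continuous.
Qed.

Lemma open_chart_preimage c (V : set 'rV[R]_(mdim M)) :
  open V -> open (cdom c `&` cmap c @^-1` V).
Proof.
move=> oV; apply: open_within => //; first exact: cdom_open.
exact: cmap_continuous.
Qed.

Lemma CinfP (f : Cinf M) c : atlas c -> smooth_on (cimg c) (f \o cinv c).
Proof. by move=> cA; case: f => f /= /asboolP; exact. Qed.

(** The transition maps carry smoothness from one chart to the others. *)
Lemma smooth_fun_local (f : M -> R) :
  (forall p, exists c W, [/\ atlas c, cdom c p, open W, W p &
     smooth_on (cmap c @` (cdom c `&` W)) (f \o cinv c)]) ->
  f \in @smooth_fun R M.
Proof.
move=> H; apply/asboolP => c0 c0A.
apply: smooth_on_local => [|y /cimg_cinv[c0q yE]].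
  by apply: open_thick; exact: cimg_open.
set q := cinv c0 y in c0q yE *.
have [c [W [cA cq oW Wq fs]]] := H q.
have oC : open (cdom c `&` W) by apply: openI => //; exact: cdom_open.
exists (cmap c0 @` (cdom c0 `&` (cdom c `&` W))); split.
- exact: open_chart_image.
- by exists q.
apply: (smooth_on_sub (D := cmap c0 @` (cdom c0 `&` (cdom c `&` W)))).
  by move=> ? [].
apply: (smooth_on_ext (f := (f \o cinv c) \o (fun z => cmap c (cinv c0 z)))).
  by move=> _ [r [c0r [cr Wr]] <-] /=; rewrite !cmapK.
apply: (smooth_on_comp (U := cmap c @` (cdom c `&` W))) => //.
- exact: open_chart_image.
- by move=> _ [r [c0r [cr Wr]] <-]; rewrite cmapK//; exists r.
- move=> i; apply: smooth_on_sub (atlas_smooth c0A cA i).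
  by move=> _ [r [c0r [cr Wr]] <-]; exists r.
Qed.

Lemma smooth_fun_locally_eq (f : M -> R) :
  (forall p, exists W (g : Cinf M), [/\ open W, W p &
     forall q, W q -> f q = g q]) ->
  f \in @smooth_fun R M.
Proof.
move=> H; apply: smooth_fun_local => p; have [W [g [oW Wp fg]]] := H p.
have [c cA cp] := atlas_cover p; exists c, W; split=> //.
apply: (smooth_on_ext (f := g \o cinv c)).
  by move=> _ [q [cq Wq] <-] /=; rewrite cmapK// fg.
by apply: smooth_on_sub (CinfP g cA) => _ [q [cq Wq] <-]; exact: cimg_cmap.
Qed.

Definition extend_by_zero c (g : 'rV[R]_(mdim M) -> R) (q : M) : R :=
  if `[< cdom c q >] then g (cmap c q) else 0.

Lemma extend_by_zeroE c g q : cdom c q -> extend_by_zero c g q = g (cmap c q).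
Proof. by move=> cq; rewrite /extend_by_zero asboolT. Qed.

(** The image of [K] in [M] is compact, hence closed as [M] is separated, so
    that the extension vanishes near every point outside the chart. *)
Lemma extend_by_zero_smooth c g (K : set 'rV[R]_(mdim M)) : atlas c ->
  smooth_on (cimg c) g -> compact K -> K `<=` cimg c ->
  (forall y, ~ K y -> g y = 0) -> extend_by_zero c g \in @smooth_fun R M.
Proof.
move=> cA gs cK Kc gK; apply: smooth_fun_local => p.
have [cp|ncp] := pselect (cdom c p).
  exists c, setT; split=> //; first exact: openT.
  rewrite setIT; apply: smooth_on_ext gs => _ [q cq <-] /=.
  by rewrite cmapK// extend_by_zeroE.
have K'cl : closed (cinv c @` K).
  apply: compact_closed; first exact: manifold_hausdorff.
  apply: continuous_compact => //.
  by apply: continuous_subspaceW (@cinv_continuous _ _ _ c); exact: Kc.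
have [c1 c1A c1p] := atlas_cover p.
exists c1, (~` (cinv c @` K)); split=> //.
- by rewrite openC.
- by move=> [y /Kc/cimg_cinv[+ _] yp]; rewrite yp.
apply: (smooth_on_ext (f := fun=> 0)); last exact: smooth_on_cst.
move=> _ [q [c1q Kq] <-] /=; rewrite cmapK// /extend_by_zero.
case: asboolP => // cq; rewrite gK// => Kcq; apply: Kq.
by exists (cmap c q); rewrite ?cmapK.
Qed.

(** The neighbourhood [W] is chosen so that [beta] is constantly [1] near each
    of its points: multiplication by [beta] then preserves derivatives there. *)
Lemma chart_bump c p (V : set 'rV[R]_(mdim M)) : cdom c p -> open V ->
  V (cmap c p) -> exists beta K W,
    [/\ smooth_on setT beta, compact K, K `<=` V,
        forall y, ~ K y -> beta y = 0 &
        [/\ open W, W p, W `<=` cdom c & forall q, W q ->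
          V (cmap c q) /\ \forall y \near cmap c q, beta y = 1]].
Proof.
move=> cp oV Vp.
have /nbhs_ballP[r /= r0 rV] := open_nbhs_nbhs (conj oV Vp).
have [beta [K [bs b1 cK Kr bK]]] := bump_rV (cmap c p) r0.
pose U := interior [set y | beta y = 1].
exists beta, K, (cdom c `&` cmap c @^-1` (V `&` U)); split=> //.
  by move=> y /Kr /rV.
split.
- by apply: open_chart_preimage; apply: openI => //; exact: open_interior.
- by split.
- by move=> q [].
- by move=> q [cq [Vq Uq]]; split.
Qed.

Lemma smooth_extension c p (V : set 'rV[R]_(mdim M)) g : atlas c -> cdom c p ->
  open V -> V `<=` cimg c -> V (cmap c p) -> smooth_on V g ->
  exists (f : Cinf M) W, [/\ open W, W p, W `<=` cdom c &
    forall q, W q -> V (cmap c q) /\ f q = g (cmap c q)].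
Proof.
move=> cA cp oV Vc Vp gs.
have [beta [K [W [bs cK KV bK [oW Wp Wc WV]]]]] := chart_bump cp oV Vp.
have fs : extend_by_zero c (fun y => beta y * g y) \in @smooth_fun R M.
  apply: (@extend_by_zero_smooth c _ K) => //.
  - exact: (smooth_on_sub _ (cutoff_smooth oV cK KV bs bK gs)).
  - by move=> y /KV /Vc.
  - by move=> y /bK ->; rewrite mul0r.
exists (MkCinf fs), W; split=> // q Wq; have [Vq b1] := WV q Wq; split=> //=.
by rewrite extend_by_zeroE ?(nbhs_singleton b1) ?mul1r//; exact: Wc.
Qed.

Lemma bump_function p (W : set M) : open W -> W p ->
  exists psi : Cinf M, psi p = 1 /\ forall q, ~ W q -> psi q = 0.
Proof.
move=> oW Wp; have [c cA cp] := atlas_cover p.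
have Vp : (cmap c @` (cdom c `&` W)) (cmap c p) by exists p.
have [beta [K [W' [bs cK KV bK [oW' W'p W'c W'V]]]]] :=
  chart_bump cp (open_chart_image (c := c) oW) Vp.
have fs : extend_by_zero c beta \in @smooth_fun R M.
  apply: (@extend_by_zero_smooth c _ K) => //.
    exact: smooth_on_sub bs.
  by move=> y /KV [q [cq _] <-]; exact: cimg_cmap.
exists (MkCinf fs); split=> /= [|q Wq].
  by rewrite extend_by_zeroE// (nbhs_singleton (W'V p W'p).2).
rewrite /extend_by_zero; case: asboolP => // cq.
by apply: bK => /KV [r [cr Wr] rq]; apply: Wq; rewrite -(cmapK cq) -rq cmapK.
Qed.

End Charts.

(** * Derivations at a point *)

Section Derivations.
Context {R : realType} {M : manifold R}.
Implicit Types (c : chart R M (mdim M)) (p q : M) (f g : Cinf M).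

Lemma Cinf0E q : (0 : Cinf M) q = 0. Proof. by []. Qed.
Lemma Cinf1E q : (1 : Cinf M) q = 1. Proof. by []. Qed.
Lemma CinfBE f g q : (f - g) q = f q - g q. Proof. by []. Qed.

Lemma Cinf_sumE (I : Type) (r : seq I) (f : I -> Cinf M) q :
  (\sum_(i <- r) f i) q = \sum_(i <- r) f i q.
Proof. by elim/big_rec2: _ => // i a b _ <-. Qed.

Lemma vat_tangent (X : vfield M) q : tangent q (vat X q).
Proof.
split=> [a f g|f g]; rewrite /vat.
- by rewrite vf_linear.
- by rewrite vf_leibniz.
Qed.

Lemma bv_tangent (Q : bivector M) f q : tangent q (fun g => Q f g q).
Proof. exact: (vat_tangent (sharp Q f)). Qed.

Lemma bv_skewE (Q : bivector M) f g q : Q f g q = - Q g f q.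
Proof. by rewrite bv_skew. Qed.

Section At.
Context {p : M} {v : Cinf M -> R} (vt : tangent p v).

Lemma tangentD f g : v (f + g) = v f + v g.
Proof. by have [vl _] := vt; have := vl 1 f g; rewrite scale1r mul1r. Qed.

Lemma tangentM f g : v (f * g) = v f * g p + f p * v g.
Proof. by case: vt. Qed.

Lemma tangent0 : v 0 = 0.
Proof. by apply: (addrI (v 0)); rewrite -tangentD !addr0. Qed.

Lemma tangentZ a f : v (a *: f) = a * v f.
Proof. by have [vl _] := vt; rewrite -[a *: f]addr0 vl tangent0 addr0. Qed.

Lemma tangentN f : v (- f) = - v f.
Proof. by rewrite -scaleN1r tangentZ mulN1r. Qed.

Lemma tangentB f g : v (f - g) = v f - v g.
Proof. by rewrite tangentD tangentN. Qed.

Lemma tangent_sum (I : Type) (r : seq I) (f : I -> Cinf M) :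
  v (\sum_(i <- r) f i) = \sum_(i <- r) v (f i).
Proof.
elim: r => [|i r IH]; first by rewrite !big_nil tangent0.
by rewrite !big_cons tangentD IH.
Qed.

Lemma tangent1 : v 1 = 0.
Proof.
have := tangentM 1 1; rewrite mulr1 Cinf1E mulr1 mul1r => e.
by apply: (addrI (v 1)); rewrite -e addr0.
Qed.

(** Multiply [f - g] by a bump function at [p] supported in [W]: the product is
    zero, and the Leibniz rule gives [v (f - g) = 0]. *)
Lemma tangent_local (W : set M) f g : open W -> W p ->
  (forall q, W q -> f q = g q) -> v f = v g.
Proof.
move=> oW Wp fg; have [psi [psi1 psi0]] := bump_function oW Wp.
have e : (f - g) * psi = 0.
  apply: Cinf_eq => q; rewrite CinfME CinfBE.
  have [Wq|nWq] := pselect (W q); first by rewrite fg// subrr mul0r.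
  by rewrite psi0// mulr0.
apply/eqP; rewrite -subr_eq0 -tangentB; apply/eqP.
have := tangentM (f - g) psi; rewrite e tangent0 psi1 mulr1 CinfBE fg//.
by rewrite subrr mul0r addr0 => <-.
Qed.

End At.

End Derivations.

(** * Local frames *)

Section Frames.
Context {R : realType} {M : manifold R}.
Implicit Types (c : chart R M (mdim M)) (p q : M) (f g : Cinf M).

(** Frames play the role of coordinates in all later computations; being made of
    global functions and fields, they can be fed to tensors and derivations. *)
Definition frame_on n (W : set M) (x : 'I_n -> Cinf M) (d : 'I_n -> vfield M) :=
  forall q, W q -> (forall i j, d i (x j) q = (i == j)%:R) /\
    forall v, tangent q v -> forall f, v f = \sum_i v (x i) * d i f q.

Section ChartFrame.
Variables (c : chart R M (mdim M)) (cA : atlas c).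

Let cimg_thick : thick (cimg c) := open_thick (@cimg_open _ _ _ c).

Definition chart_partial (i : 'I_(mdim M)) f : 'rV[R]_(mdim M) -> R :=
  s2val (cid2 (smooth_on_partial i cimg_thick (CinfP f cA))).

Lemma chart_partialP i f y : cimg c y ->
  is_derive_in (cimg c) (f \o cinv c) y (delta_mx 0 i) (chart_partial i f y).
Proof.
exact: (s2valP (cid2 (smooth_on_partial i cimg_thick (CinfP f cA)))).
Qed.

Lemma chart_partial_smooth i f : smooth_on (cimg c) (chart_partial i f).
Proof.
exact: (s2valP' (cid2 (smooth_on_partial i cimg_thick (CinfP f cA)))).
Qed.

Lemma chart_partial_eq i f y l : cimg c y ->
  is_derive_in (cimg c) (f \o cinv c) y (delta_mx 0 i) l ->
  chart_partial i f y = l.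
Proof.
move=> cy fl; apply: (is_derive_in_unique (cimg_thick cy i)) fl.
exact: chart_partialP.
Qed.

Variables (beta : 'rV[R]_(mdim M) -> R) (K : set 'rV[R]_(mdim M)).
Hypotheses (betas : smooth_on setT beta) (cK : compact K) (Kc : K `<=` cimg c).
Hypothesis betaK : forall y, ~ K y -> beta y = 0.

Lemma chart_field_smooth i f :
  extend_by_zero c (fun y => beta y * chart_partial i f y) \in @smooth_fun R M.
Proof.
apply: (@extend_by_zero_smooth _ _ c _ K) => //.
  apply: smooth_onM; first exact: smooth_on_sub betas.
  exact: chart_partial_smooth.
by move=> y /betaK ->; rewrite mul0r.
Qed.

Definition chart_field (i : 'I_(mdim M)) : vfield M.
Proof.
exists (fun f => MkCinf (chart_field_smooth i f)) => [a f g|f g];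
  apply: Cinf_eq => q; rewrite !CinfE /= /extend_by_zero;
  case: asboolP => cq; rewrite ?(mulr0, mul0r, addr0)//.
  rewrite (@chart_partial_eq i _ _ (a * chart_partial i f (cmap c q) +
    chart_partial i g (cmap c q))); first by ring.
    exact: cimg_cmap.
  apply: (@is_derive_inD _ _ _ (fun y => a * f (cinv c y)) (g \o cinv c)).
    by apply: is_derive_inZ; apply: chart_partialP; exact: cimg_cmap.
  by apply: chart_partialP; exact: cimg_cmap.
rewrite (@chart_partial_eq i _ _ (chart_partial i f (cmap c q) * g q +
  f q * chart_partial i g (cmap c q))); first by ring.
  exact: cimg_cmap.
have cq' := cimg_cmap cq.
have := is_derive_inM (chart_partialP (i := i) (f := f) cq')
  (chart_partialP (i := i) (f := g) cq').
by rewrite /= (cmapK cq).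
Defined.

End ChartFrame.

(** The coordinates and the coordinate fields, cut off outside a neighbourhood
    of [p].  That the fields span all the derivations at a point follows from
    Hadamard's lemma there, applied to a local expression of the function. *)
Lemma chart_frame c p : atlas c -> cdom c p ->
  exists (x : 'I_(mdim M) -> Cinf M) (d : 'I_(mdim M) -> vfield M) W,
    [/\ open W, W p, W `<=` cdom c, frame_on W x d &
      forall q, W q -> forall i f,
        is_derive_in (cimg c) (f \o cinv c) (cmap c q) (delta_mx 0 i)
          (d i f q)].
Proof.
move=> cA cp; have oc := @cimg_open _ _ _ c.
have [beta [K [W1 [bs cK Kc bK [oW1 W1p W1c W1b]]]]] :=
  chart_bump cp oc (cimg_cmap cp).
pose d := chart_field cA bs cK Kc bK.
have /choice[xW xWP] i : exists xW : Cinf M * set M, [/\ open xW.2, xW.2 p &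
    forall q, xW.2 q -> xW.1 q = cmap c q 0 i].
  have [f [W [oW Wp Wc Wf]]] := smooth_extension cA cp oc (@subset_refl _ _)
    (cimg_cmap cp) (@smooth_on_coord _ _ (cimg c) i).
  by exists (f, W); split=> // q /Wf[].
pose x i := (xW i).1.
pose W2 := interior [set q | forall i, (xW i).2 q].
have W2x q i : W2 q -> x i q = cmap c q 0 i.
  by move=> /interior_subset /(_ i); have [_ _] := xWP i; exact.
have oW2 : open W2 by exact: open_interior.
have oW : open (W1 `&` W2) by exact: openI.
have dE q i f : W1 q -> d i f q = chart_partial cA i f (cmap c q).
  move=> W1q; rewrite /d /= extend_by_zeroE; last exact: W1c.
  by rewrite (nbhs_singleton (W1b q W1q).2) mul1r.
have dP q : (W1 `&` W2) q -> forall i f,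
    is_derive_in (cimg c) (f \o cinv c) (cmap c q) (delta_mx 0 i) (d i f q).
  move=> [W1q _] i f; rewrite dE//; apply: chart_partialP.
  by apply: cimg_cmap; exact: W1c.
exists x, d, (W1 `&` W2); split=> //.
- split=> //; apply: filter_forall => i; apply: open_nbhs_nbhs.
  by have [] := xWP i.
- by move=> q [/W1c].
move=> q Wq; have [W1q W2q] := Wq; have cq := W1c q W1q.
have dx i j : d i (x j) q = (i == j)%:R.
  rewrite dE//; apply: chart_partial_eq; first exact: cimg_cmap.
  have oD : open (cmap c @` (cdom c `&` W2)) by exact: open_chart_image.
  apply: (@is_derive_in_near _ _ _ (cmap c @` (cdom c `&` W2))).
    by apply: near_line => //; exists q.
  apply: (@is_derive_in_ext _ _ _ (fun y : 'rV[R]_(mdim M) => y 0 j)).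
  - by split; [exact: cimg_cmap|exists q].
  - by move=> _ [_ [r [cr W2r] <-]] /=; rewrite cmapK// W2x.
  have := @is_derive_in_coord R _ (cimg c `&` cmap c @` (cdom c `&` W2)) j
    (cmap c q) (delta_mx 0 i).
  by rewrite mxE eqxx eq_sym.
split=> // v vt f.
have [V [G [oV Vq Vc Gs [fG Gd]]]] := hadamard oc (cimg_cmap cq) (CinfP f cA).
have /choice[gW gWP] i : exists gW : Cinf M * set M, [/\ open gW.2, gW.2 q,
    gW.2 `<=` cdom c & forall r, gW.2 r -> gW.1 r = G i (cmap c r)].
  have [g [W [oW' Wq' Wc' Wg]]] := smooth_extension cA cq oV Vc Vq (Gs i).
  by exists (g, W); split=> // r /Wg[].
pose g i := (gW i).1.
pose h : Cinf M := f q *: (1 : Cinf M) +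
  \sum_i (x i - x i q *: (1 : Cinf M)) * g i.
have fE r : (interior [set r | W2 r /\ (cdom c `&` cmap c @^-1` V) r /\
    forall i, (gW i).2 r]) r -> f r = h r.
  move=> /interior_subset[W2r [[cr Vr] Wr]].
  have -> : f r = f q +
      \sum_i (cmap c r 0 i - cmap c q 0 i) * G i (cmap c r).
    by have := fG _ Vr; rewrite /= !cmapK.
  rewrite /h CinfDE CinfZE Cinf1E mulr1 Cinf_sumE; congr (_ + _).
  apply: eq_bigr => i _; rewrite CinfME CinfBE CinfZE Cinf1E mulr1 !W2x//.
  by have [_ _ _ ->] := gWP i.
rewrite (tangent_local vt _ _ fE); last 2 first.
- exact: open_interior.
- apply: filterI; first exact: open_nbhs_nbhs.
  apply: filterI.
    by apply: open_nbhs_nbhs; split=> //; exact: open_chart_preimage.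
  by apply: filter_forall => i; apply: open_nbhs_nbhs; have [] := gWP i.
rewrite /h (tangentD vt) (tangentZ vt) (tangent1 vt) mulr0 add0r.
rewrite (tangent_sum vt).
apply: eq_bigr => i _; rewrite (tangentM vt) (tangentB vt) (tangentZ vt).
rewrite (tangent1 vt) mulr0 subr0 CinfBE CinfZE Cinf1E mulr1 subrr mul0r addr0.
congr (_ * _); rewrite /g; have [_ q2 _ ->//] := gWP i.
have cq' := cimg_cmap cq.
exact: (is_derive_in_unique (open_thick oc cq' i) (Gd i) (dP q Wq i f)).
Qed.

End Frames.

(** * Smooth families of functions *)

Section Families.
Context {R : realType} {M : manifold R}.
Local Notation I01 := (unit_interval : set R^o).
Implicit Types (c : chart R M (mdim M)) (p q : M) (f g : R -> Cinf M).

Definition in_chart c (f : R -> M -> R) : 'rV[R]_(1 + mdim M) -> R :=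
  slab_fun (fun t y => f t (cinv c y)).

Lemma smooth_familyD f g : smooth_family f -> smooth_family g ->
  smooth_family (fun t => f t + g t).
Proof. by move=> fs gs c cA; exact: smooth_onD (fs c cA) (gs c cA). Qed.

Lemma smooth_familyM f g : smooth_family f -> smooth_family g ->
  smooth_family (fun t => f t * g t).
Proof. by move=> fs gs c cA; exact: smooth_onM (fs c cA) (gs c cA). Qed.

Lemma smooth_family_sum (I : Type) (r : seq I) (f : I -> R -> Cinf M) :
  (forall i, smooth_family (f i)) ->
  smooth_family (fun t => \sum_(i <- r) f i t).
Proof.
move=> fs c cA; have := @smooth_on_sum _ _ _ _ r _ (fun i => fs i c cA).
by apply: smooth_on_ext => z _; rewrite Cinf_sumE.
Qed.

Lemma smooth_family_local f :
  (forall p, exists W g, [/\ open W, W p, smooth_family g &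
     forall t, unit_interval t -> forall q, W q -> f t q = g t q]) ->
  smooth_family f.
Proof.
move=> H c cA; apply: smooth_on_slab_local => [|y cy]; first exact: cimg_open.
have [cp yE] := cimg_cinv cy; have [W [g [oW Wp gs fg]]] := H (cinv c y).
exists (cmap c @` (cdom c `&` W)); split.
- exact: open_chart_image.
- by exists (cinv c y).
apply: (smooth_on_ext (f := in_chart c g)).
  move=> z [z0 [q [cq Wq] zE]]; rewrite /in_chart /slab_fun -zE cmapK//.
  by rewrite fg.
apply: smooth_on_sub (gs c cA) => z [z0 [q [cq Wq] zE]]; split=> //.
by rewrite -zE; exact: cimg_cmap.
Qed.

(** This turns a construction made point by point into a smooth family, as soon
    as it has smooth local expressions. *)
Lemma smooth_family_glue (a : R -> M -> R) :
  (forall p, exists W g, [/\ open W, W p, smooth_family g &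
     forall t, unit_interval t -> forall q, W q -> a t q = g t q]) ->
  exists f, smooth_family f /\
    forall t, unit_interval t -> forall q, f t q = a t q.
Proof.
move=> H.
have /choice[f fP] t : exists f : Cinf M,
    unit_interval t -> forall q, f q = a t q.
  have [t01|nt01] := pselect (unit_interval t); last by exists 0.
  have as_ : a t \in @smooth_fun R M.
    apply: smooth_fun_locally_eq => p; have [W [g [oW Wp gs ag]]] := H p.
    by exists W, (g t); split=> // q; exact: ag.
  by exists (MkCinf as_).
exists f; split=> //; apply: smooth_family_local => p.
have [W [g [oW Wp gs ag]]] := H p; exists W, g; split=> // t t01 q Wq.
by rewrite fP// ag.
Qed.

Lemma smooth_family_derivable f : smooth_family f ->
  forall t q, unit_interval t ->
    exists l, is_derive_in I01 (fun s => f s q) t 1 l.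
Proof.
move=> fs t q t01; have [c cA cq] := atlas_cover q; have cq' := cimg_cmap cq.
have [_ /(_ 0)[g fg _]] := fs c cA 1%N.
have /fg : slab (cimg c) (slab_point t (cmap c q)) by apply/slabE.
move=> /(slab_derive_time (fun s y => f s (cinv c y)) _ _ cq').
by rewrite (cmapK cq); exists (g (slab_point t (cmap c q))).
Qed.

(** In coordinates [Y_t h_t] is the sum of the [Y_t x_i] times the partial
    derivatives of [h_t]. *)
Lemma smooth_vfamily_apply (Y : R -> vfield M) h :
  smooth_vfamily Y -> smooth_family h -> smooth_family (fun t => Y t (h t)).
Proof.
move=> Ys hs c cA; apply: smooth_on_slab_local => [|y cy].
  exact: cimg_open.
have [cp yE] := cimg_cinv cy.
have [x [d [W [oW Wp Wc fr dP]]]] := chart_frame cA cp.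
have oV := open_chart_image (c := c) oW.
pose V := cmap c @` (cdom c `&` W).
exists V; split=> //; first by exists (cinv c y).
have Vc : V `<=` cimg c by move=> _ [q [cq _] <-]; exact: cimg_cmap.
apply: (smooth_on_ext (f := fun z => \sum_i in_chart c (fun t => Y t (x i)) z *
    in_chart c (fun t => d i (h t)) z)).
  move=> z [z0 [q [cq Wq] zE]]; rewrite /in_chart /slab_fun -zE cmapK//.
  exact/esym/((fr q Wq).2 _ (vat_tangent _ _)).
apply: smooth_on_sum => i; apply: smooth_onM.
  by apply: smooth_on_sub (Ys (x i) c cA) => z [z0 /Vc].
have hsV : smooth_on (slab V) (in_chart c h).
  by apply: smooth_on_sub (hs c cA) => z [z0 /Vc].
move=> k; apply: (Ck_on_partial (i := rshift 1 i)) (hsV k.+1).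
  exact: slab_thick.
apply: slab_forall => t _ t01 [q [cq Wq] <-].
rewrite /in_chart slab_funE slab_derive_space// cmapK//.
by apply: is_derive_in_sub (dP q Wq i (h t)); exact: Vc.
Qed.

(** Primitives are taken point by point, and are smooth in each chart by
    [slab_primitive_smooth].  A derivation at [q] is a combination of partial
    derivatives in a frame, and for these the exchange with integration in time
    is [slab_primitive_partial]. *)
Lemma smooth_family_primitive f : smooth_family f ->
  exists A : R -> Cinf M, [/\ smooth_family A, forall q, A 0 q = 0,
    (forall q t, unit_interval t ->
       is_derive_in I01 (fun s => A s q) t 1 (f t q)) &
    (forall q v, tangent q v -> forall t, unit_interval t ->
       is_derive_in I01 (fun s => v (A s)) t 1 (v (f t)))].
Proof.
move=> fs.
have /choice[a aP] q : exists a : R -> R, a 0 = 0 /\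
    forall t, I01 t -> is_derive_in I01 a t 1 (f t q).
  have [c cA cq] := atlas_cover q; have cq' := cimg_cmap cq.
  have [G GP] := slab_primitive_exists (f := fun t y => f t (cinv c y))
    (Ck_on_continuous (fs c cA 0%N)).
  have := GP _ cq'; rewrite (cmapK cq) => qP.
  by exists (G^~ (cmap c q)).
have aprim c : slab_primitive (cimg c) (fun t y => f t (cinv c y))
    (fun t y => a (cinv c y) t).
  by move=> y _; exact: aP.
have as_ c : atlas c ->
    smooth_on (slab (cimg c)) (in_chart c (fun t q => a q t)).
  move=> cA; apply: slab_primitive_smooth (fs c cA) (aprim c).
  exact: cimg_open.
have ats t : unit_interval t -> (fun q => a q t) \in @smooth_fun R M.
  move=> t01; apply/asboolP => c cA k.
  have := Ck_on_slice t01 (as_ c cA k); apply: Ck_on_ext => y _.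
  by rewrite /in_chart slab_funE.
have /choice[A AP] t : exists A : Cinf M,
    unit_interval t -> forall q, A q = a q t.
  have [t01|nt01] := pselect (unit_interval t); last by exists 0.
  by exists (MkCinf (ats t t01)).
have I0 : unit_interval (0 : R) by rewrite /unit_interval /= lexx ler01.
have AE q t l : unit_interval t -> is_derive_in I01 (a q) t 1 l ->
    is_derive_in I01 (fun s => A s q) t 1 l.
  by move=> t01; apply: is_derive_in_ext => // s s01; rewrite AP.
exists A; split.
- move=> c cA; apply: smooth_on_ext (as_ c cA) => z [z0 _].
  by rewrite /in_chart /slab_fun AP.
- by move=> q; rewrite AP// (aP q).1.
- by move=> q t t01; apply: AE => //; exact: (aP q).2.
move=> q v vt t t01; have [c cA cq] := atlas_cover q; have cq' := cimg_cmap cq.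
have [x [d [W [oW Wq Wc fr dP]]]] := chart_frame cA cq.
have [_ vE] := fr q Wq.
under [X in is_derive_in _ X]eq_fun do rewrite (vE _ vt).
rewrite (vE _ vt).
apply: (@is_derive_in_sum _ _ _ _ _ (fun i s => v (x i) * d i (A s) q) t 1
  (fun i => v (x i) * d i (f t) q)) => i.
apply: (@is_derive_inZ _ _ _ (fun s => d i (A s) q)).
have oc := @cimg_open _ _ _ c.
have [g' fg' gs] := smooth_on_partial (rshift 1 i) (slab_thick oc) (fs c cA).
pose g t y := g' (slab_point t y).
have gE : slab_fun g = g'.
  by apply/funext => z; rewrite /slab_fun /g slab_pointK.
have gc : {within slab (cimg c), continuous (slab_fun g)}.
  by rewrite gE; exact: Ck_on_continuous (gs 0%N).
have [G GP] := slab_primitive_exists gc.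
have fgx s y : unit_interval s -> cimg c y ->
    is_derive_in (cimg c) (fun y => f s (cinv c y)) y (delta_mx 0 i) (g s y).
  move=> s01 cy.
  apply/(slab_derive_space (cimg c) (fun t y => f t (cinv c y)) y i _ s01).
  by apply: fg'; apply/slabE.
have GE s : unit_interval s -> d i (A s) q = G s (cmap c q).
  move=> s01.
  have := slab_primitive_partial oc gc fgx (aprim c) GP s01 cq'.
  apply: (is_derive_in_unique (open_thick oc cq' i)).
  apply: is_derive_in_ext (dP q Wq i (A s)) => // y _ /=; exact: AP.
have -> : d i (f t) q = g t (cmap c q).
  apply: (is_derive_in_unique (open_thick oc cq' i)) (fgx _ _ t01 cq').
  exact: dP.
apply: is_derive_in_ext ((GP _ cq').2 t t01) => // s s01.
by rewrite GE.
Qed.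

End Families.

(** * Functions and vectors over the base *)

Section PullBack.
Context {R : realType} {E B : manifold R} (pi : E -> B).
Hypothesis pis : smooth_map_on setT pi.

Lemma smooth_map_cont : continuous pi.
Proof. by apply/continuous_subspace_setT; case: pis. Qed.

Lemma pull_smooth (b : Cinf B) : (b \o pi) \in @smooth_fun R E.
Proof.
apply: smooth_fun_local => p.
have [c cA cp] := atlas_cover p; have [c' c'A c'p] := atlas_cover (pi p).
have oW : open (pi @^-1` cdom c').
  by apply: open_comp => [x _|]; [exact: smooth_map_cont|exact: cdom_open].
exists c, (pi @^-1` cdom c'); split=> //.
apply: (smooth_on_ext
  (f := (b \o cinv c') \o (fun x => cmap c' (pi (cinv c x))))).
  by move=> _ [q [cq Wq] <-] /=; rewrite !cmapK.
apply: (smooth_on_comp (U := cimg c')).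
- exact: cimg_open.
- by move=> _ [q [cq Wq] <-]; rewrite cmapK//; exact: cimg_cmap.
- move=> i; apply: smooth_on_sub (pis.2 c c' cA c'A i).
  by move=> _ [q [cq Wq] <-]; exists q.
- exact: CinfP.
Qed.

Definition pull (b : Cinf B) : Cinf E := MkCinf (pull_smooth b).

Lemma pullE b e : pull b e = b (pi e). Proof. by []. Qed.

Lemma pulled_back_eq f b : pulled_back pi f b -> f = pull b.
Proof. by move=> fb; apply: Cinf_eq => e; rewrite fb. Qed.

Lemma pullD b b' : pull (b + b') = pull b + pull b'.
Proof. exact: Cinf_eq. Qed.

Lemma pullZ a b : pull (a *: b) = a *: pull b.
Proof. exact: Cinf_eq. Qed.

Lemma pullM b b' : pull (b * b') = pull b * pull b'.
Proof. exact: Cinf_eq. Qed.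

Lemma push_tangent e v : tangent e v -> tangent (pi e) (fun b => v (pull b)).
Proof.
move=> vt; split=> [a b b'|b b'].
  by rewrite pullD pullZ (tangentD vt) (tangentZ vt).
by rewrite pullM (tangentM vt).
Qed.

Lemma hor_pull (G : connection pi) u b : hor G u (pull b) = pull (u b).
Proof. by apply: Cinf_eq => e; exact: (@hor_lift _ _ _ _ G u e (pull b) b). Qed.

Lemma vertical_pull e v b : vertical pi e v -> v (pull b) = 0.
Proof. by move=> [_ /(_ (pull b) b)]; exact. Qed.

(** The difference of the two sides is horizontal.  It is also vertical, because
    both sides agree on functions pulled back from the base, where the frame
    determines derivations.  Hence it is zero. *)
Lemma horizontal_frame (G : connection pi) n W (x : 'I_n -> Cinf B)
    (d : 'I_n -> vfield B) e v f :
  frame_on W x d -> W (pi e) -> hspace G e v ->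
  v f = \sum_i v (pull (x i)) * hor G (d i) f e.
Proof.
move=> fr Wpe Hv; have vt := hspace_tangent Hv.
pose w f := v f - \sum_i v (pull (x i)) * hor G (d i) f e.
have Hw : hspace G e w.
  rewrite /w; elim: (index_enum _) => [|i r IH].
    rewrite (_ : (fun f => _) = v)//.
    by apply/funext => g; rewrite big_nil subr0.
  have := hspace_linear (- v (pull (x i))) (hor_hspace G (d i) e) IH.
  congr hspace; apply/funext => g; rewrite big_cons /vat; ring.
suff : w = cst 0 by move=> /(congr1 (@^~ f))/eqP; rewrite subr_eq0 => /eqP.
apply: ((hspace_compl G e).1 w Hw); split; first exact: (hspace_tangent Hw).
move=> g b /pulled_back_eq ->; apply/eqP; rewrite subr_eq0; apply/eqP.
rewrite ((fr _ Wpe).2 _ (push_tangent vt)); apply: eq_bigr => i _.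
by rewrite hor_pull.
Qed.

End PullBack.

(** * Algebra of the coupling data at a fixed time *)

Section Coupling.
Context {R : realType} {E B : manifold R} (pi : E -> B).
Hypothesis pis : smooth_map_on setT pi.
Variables (P Ups : bivector E) (G : connection pi) (F : form2 pi).
Hypothesis data : geometric_data P Ups G F.
Local Notation pb := (pull pis).

Lemma Upsilon_vertical : vertical_bivector pi Ups.
Proof. by have [_ [PH []]] := data. Qed.

Lemma Upsilon_pull f b e : Ups f (pb b) e = 0.
Proof. exact: (vertical_pull pis b (Upsilon_vertical f e)). Qed.

Lemma Upsilon_annihilates e f g : annihilates_vertical pi e f -> Ups f g e = 0.
Proof.
by move=> fv; rewrite bv_skewE [Ups g f e](fv _ (Upsilon_vertical g e)) oppr0.
Qed.

Lemma hor_annihilator e u : exists f, annihilates_vertical pi e f /\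
  forall g, P f g e = hor G u g e.
Proof.
have [HE _] := data; have := hor_hspace G u e; rewrite HE => -[f fv fu].
by exists f; split=> // g; rewrite -[RHS]/(vat (hor G u) e g) -fu.
Qed.

Lemma horizontal_part e f : hspace G e (fun k => P f k e - Ups f k e).
Proof.
have [_ [PH [PHE PHh _ _]]] := data.
have := PHh f e; congr hspace; apply/funext => k.
by rewrite PHE CinfDE addrK.
Qed.

(** Puts [P f (pb b)] in a form to which the frame expansion of the horizontal
    vector [horizontal_part] applies. *)
Lemma P_pull f b e : P f (pb b) e = P f (pb b) e - Ups f (pb b) e.
Proof. by rewrite Upsilon_pull subr0. Qed.

(** [F u v] is by definition the pairing of the covectors that [P_H] sends to
    the lifts of [u] and [v]; on covectors annihilating the vertical space [P_H]
    agrees with [P]. *)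
Lemma coupling_formE e u v f : annihilates_vertical pi e f ->
  (forall g, P f g e = hor G v g e) -> F u v e = hor G u f e.
Proof.
move=> fv fP; have [f' [f'v f'P]] := hor_annihilator e u.
have [_ [PH [PHE _ _ [_ PF]]]] := data.
have PHP k g : annihilates_vertical pi e k -> PH k g e = P k g e.
  by move=> kv; rewrite PHE CinfDE (Upsilon_annihilates g kv) addr0.
rewrite -(PF e f' f u v f'v fv).
- by rewrite PHP.
- by apply/funext => g; rewrite /vat /= PHP.
- by apply/funext => g; rewrite /vat /= PHP.
Qed.

Section Frame.
Variables (n : nat) (W : set B) (x : 'I_n -> Cinf B) (d : 'I_n -> vfield B).
Hypothesis fr : frame_on W x d.
Variables (e : E) (We : W (pi e)).

Lemma pairing_frame v u f : hspace G e v -> annihilates_vertical pi e f ->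
  (forall g, P f g e = hor G u g e) ->
  v f = \sum_i v (pb (x i)) * F (d i) u e.
Proof.
move=> Hv fv fP; rewrite (horizontal_frame pis f fr We Hv).
by apply: eq_bigr => i _; rewrite (coupling_formE (d i) fv fP).
Qed.

(** The covector that [P] sends to the lift of [u] is [sum_i F (d i) u dx_i],
    as seen by evaluating it on the horizontal part of [P f]. *)
Lemma hor_coupling u f :
  hor G u f e = \sum_i F (d i) u e * P (pb (x i)) f e.
Proof.
have [fu [fuv fuP]] := hor_annihilator e u.
have PUps : P f fu e = P f fu e - Ups f fu e.
  by rewrite [Ups f fu e](fuv _ (Upsilon_vertical f e)) subr0.
rewrite -fuP bv_skewE PUps.
rewrite (pairing_frame (horizontal_part e f) fuv fuP) -sumrN.
by apply: eq_bigr => i _; rewrite -P_pull [P _ f e]bv_skewE; ring.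
Qed.

(** The sum is the horizontal part of [P], expanded in the frame. *)
Lemma Upsilon_frame g f :
  Ups g f e = P g f e - \sum_i P (pb (x i)) f e * hor G (d i) g e.
Proof.
have := horizontal_frame pis g fr We (horizontal_part e f).
rewrite [P f g e]bv_skewE [Ups f g e]bv_skewE => H.
rewrite (eq_bigr (fun i => - ((P f (pb (x i)) e - Ups f (pb (x i)) e) *
  hor G (d i) g e))); first by rewrite sumrN -H; ring.
by move=> i _; rewrite -P_pull [P f _ e]bv_skewE mulNr opprK.
Qed.

Lemma hor_frame u f : hor G u f e = \sum_i u (x i) (pi e) * hor G (d i) f e.
Proof.
have := horizontal_frame pis f fr We (hor_hspace G u e).
rewrite /vat => ->; apply: eq_bigr => i _.
by rewrite hor_pull pullE.
Qed.

(** [F] is a tensor: it depends on [u] only through its components, because the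
    lift of [u] does ([hor_frame]). *)
Lemma F_frame v u : F v u e = \sum_k u (x k) (pi e) * F v (d k) e.
Proof.
have [fv [fvv fvP]] := hor_annihilator e v.
rewrite form2_alt CinfNE (coupling_formE u fvv fvP) hor_frame -sumrN.
apply: eq_bigr => k _; rewrite -(coupling_formE (d k) fvv fvP).
by rewrite [F v _]form2_alt CinfNE mulrN.
Qed.

End Frame.
End Coupling.

(** * The Lie derivative along the generator *)

Section Generator.
Context {R : realType} {E B : manifold R} (pi : E -> B).
Hypothesis pis : smooth_map_on setT pi.
Variables (P Ups : bivector E) (G : connection pi) (F : form2 pi).
Hypotheses (data : geometric_data P Ups G F) (jacobi : poisson P).
Variables (X : vfield E) (h : Cinf E).
Hypothesis Xh : forall e, hspace G e (vat X e).
Local Notation pb := (pull pis).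
Variables (n : nat) (W : set B) (x : 'I_n -> Cinf B) (d : 'I_n -> vfield B).
Hypotheses (fr : frame_on W x d) (oW : open W).
(* [al u] is [F (X', u)], where [X'] is the horizontal field
   [X - P_H^sharp dh]. *)
Variable al : vfield B -> Cinf E.
Hypothesis alE : forall e, W (pi e) -> forall u,
  al u e = \sum_i F (d i) u e * (X (pb (x i)) e + P (pb (x i)) h e).

Lemma alpha_frame e u : W (pi e) ->
  al u e = \sum_k al (d k) e * u (x k) (pi e).
Proof.
move=> We; rewrite alE//.
rewrite (eq_bigr (fun i => \sum_k u (x k) (pi e) * F (d i) (d k) e *
    (X (pb (x i)) e + P (pb (x i)) h e))); last first.
  by move=> i _; rewrite (F_frame pis data fr We _ u) mulr_suml.
rewrite exchange_big; apply: eq_bigr => k _ /=; rewrite alE// mulr_suml.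
by apply: eq_bigr => i _; ring.
Qed.

Lemma tangent_alpha e v u : W (pi e) -> tangent e v ->
  v (al u) = \sum_k (v (al (d k)) * u (x k) (pi e) +
                     al (d k) e * v (pb (u (x k)))).
Proof.
move=> We vt.
have oWE : open (pi @^-1` W).
  by apply: open_comp => // ? _; exact: smooth_map_cont.
rewrite (tangent_local vt (g := \sum_k al (d k) * pb (u (x k))) oWE We).
  rewrite (tangent_sum vt); apply: eq_bigr => k _.
  by rewrite (tangentM vt) pullE.
by move=> q Wq; rewrite Cinf_sumE alpha_frame.
Qed.

(** After subtraction of the Hamiltonian field of [h] the generator is
    horizontal, with components [X (pb (x i)) + P (pb (x i)) h]; expressing the
    lifts of the [d i] by [hor_coupling] exhibits it as the contraction of [P]
    with the one-form [- sum_k al (d k) dx_k]. *)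
Lemma generator_frame e f : W (pi e) ->
  X f e + Ups h f e = P h f e - \sum_k al (d k) e * P (pb (x k)) f e.
Proof.
move=> We.
have HX := horizontal_frame pis f fr We (Xh e).
have HP := horizontal_frame pis f fr We (horizontal_part data e h).
have -> : X f e + Ups h f e = P h f e + (vat X e f - (P h f e - Ups h f e)).
  by rewrite /vat; ring.
congr (_ + _); rewrite HX HP -sumrB -sumrN.
rewrite (eq_bigr (fun i => \sum_k (X (pb (x i)) e + P (pb (x i)) h e) *
   F (d k) (d i) e * P (pb (x k)) f e)); last first.
  move=> i _; rewrite -mulrBl -(P_pull pis data) [P h _ e]bv_skewE opprK.
  rewrite (hor_coupling pis data fr We) mulr_sumr.
  by apply: eq_bigr => k _; rewrite mulrA.
rewrite exchange_big; apply: eq_bigr => k _ /=.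
rewrite -mulr_suml -mulNr alE//; congr (_ * _); rewrite -sumrN.
by apply: eq_bigr => i _; rewrite [F (d k) _]form2_alt CinfNE; ring.
Qed.

Let Z := vfield_add X (sharp Ups h).

Lemma jacobiE k f g e :
  P k (P f g) e + P g (P k f) e - P f (P k g) e = 0.
Proof.
have /(congr1 (fun f => cinf_fun f e)) := jacobi k f g.
rewrite !CinfDE Cinf0E => <-.
have -> : P k g = - P g k by rewrite bv_skew.
by rewrite [P f (- _) e](tangentN (bv_tangent P f e)); ring.
Qed.

(** The Jacobi identity removes the Hamiltonian field of [h], and, in each field
    [al (d k) * P (pb (x k))], every term where [al (d k)] is not
    differentiated. *)
Lemma lie_derivative_frame e f g : W (pi e) ->
  lie_derivative Z P f g e =
  \sum_k (P (al (d k)) g e * P (pb (x k)) f e -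
          P (al (d k)) f e * P (pb (x k)) g e).
Proof.
move=> We.
have oWE : open (pi @^-1` W).
  by apply: open_comp => // ? _; exact: smooth_map_cont.
have PZ k f' : P k (Z f') e = P k (P h f') e -
    \sum_i (P k (al (d i)) e * P (pb (x i)) f' e +
            al (d i) e * P k (P (pb (x i)) f') e).
  have kt := bv_tangent P k e.
  rewrite (tangent_local kt
    (g := P h f' - \sum_i al (d i) * P (pb (x i)) f') oWE We).
    rewrite (tangentB kt) (tangent_sum kt); congr (_ - _).
    by apply: eq_bigr => i _; rewrite (tangentM kt).
  by move=> q Wq; rewrite CinfBE Cinf_sumE; exact: generator_frame.
rewrite /lie_derivative !CinfBE [P (Z f) g e]bv_skewE !PZ.
rewrite [Z _ e]generator_frame//.
have J := jacobiE h f g e.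
rewrite [LHS](_ : _ = (P h (P f g) e + P g (P h f) e - P f (P h g) e) +
  (\sum_i (P f (al (d i)) e * P (pb (x i)) g e +
            al (d i) e * P f (P (pb (x i)) g) e) -
  (\sum_k al (d k) e * P (pb (x k)) (P f g) e +
  \sum_i (P g (al (d i)) e * P (pb (x i)) f e +
            al (d i) e * P g (P (pb (x i)) f) e)))); last by ring.
rewrite J add0r -big_split -sumrB; apply: eq_bigr => k _ /=.
have Jk := jacobiE (pb (x k)) f g e.
rewrite [P (al _) g e]bv_skewE [P (al _) f e]bv_skewE.
rewrite [LHS](_ : _ = - (al (d k) e * (P (pb (x k)) (P f g) e +
   P g (P (pb (x k)) f) e - P f (P (pb (x k)) g) e)) +
   (P f (al (d k)) e * P (pb (x k)) g e - P g (al (d k)) e * P (pb (x k)) f e)).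
  by rewrite Jk; ring.
by ring.
Qed.

Section At.
Variables (e : E) (We : W (pi e)).

Lemma hor_contract u f :
  \sum_i F (d i) u e * P f (pb (x i)) e = - hor G u f e.
Proof.
rewrite (hor_coupling pis data fr We) -sumrN; apply: eq_bigr => i _.
by rewrite [P f _ e]bv_skewE mulrN.
Qed.

Lemma lie_contract u f :
  \sum_i F (d i) u e * lie_derivative Z P (pb (x i)) f e =
  \sum_k (hor G u (al (d k)) e * P (pb (x k)) f e -
          u (x k) (pi e) * P (al (d k)) f e).
Proof.
rewrite (eq_bigr (fun i => \sum_k (P (al (d k)) f e *
    (F (d i) u e * P (pb (x k)) (pb (x i)) e) -
    P (pb (x k)) f e * (F (d i) u e * P (al (d k)) (pb (x i)) e)))); last first.
  move=> i _; rewrite lie_derivative_frame// mulr_sumr.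
  by apply: eq_bigr => k _; ring.
rewrite exchange_big; apply: eq_bigr => k _ /=.
rewrite sumrB -!mulr_sumr !hor_contract hor_pull pullE; ring.
Qed.

(** Minus the covariant differential of [al] at [(d m, u)], expressed in the
    frame; it will be the time derivative of [F (d m) u]. *)
Definition F_rate m u : R := hor G u (al (d m)) e -
  \sum_k u (x k) (pi e) * hor G (d m) (al (d k)) e.

(** The hypothesis is the time derivative of [hor_coupling] applied to
    [f = pb (x j)]: its left-hand side [u (x j)] is constant, and the derivative
    of [P] is given by the generator.  Contraction with [F (d j) (d m)] inverts
    the matrix of the [P (pb (x i)) (pb (x j))] and isolates [l m]. *)
Lemma F_rate_unique u (l : 'I_n -> R) :
  (forall j, \sum_i (l i * P (pb (x i)) (pb (x j)) e -
     F (d i) u e * lie_derivative Z P (pb (x i)) (pb (x j)) e) = 0) ->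
  forall m, l m = F_rate m u.
Proof.
move=> H m.
have dx i : hor G (d m) (pb (x i)) e = (m == i)%:R.
  by rewrite hor_pull pullE (fr We).1.
have delta (c : 'I_n -> R) : \sum_i c i * (m == i)%:R = c m.
  rewrite (bigD1 m)//= eqxx mulr1 big1 ?addr0// => i im.
  by rewrite eq_sym (negbTE im) mulr0.
have : \sum_j F (d j) (d m) e * (\sum_i (l i * P (pb (x i)) (pb (x j)) e -
     F (d i) u e * lie_derivative Z P (pb (x i)) (pb (x j)) e)) = 0.
  by apply: big1 => j _; rewrite H mulr0.
rewrite (eq_bigr (fun j => (\sum_i l i * (F (d j) (d m) e *
      P (pb (x i)) (pb (x j)) e)) -
    \sum_k (hor G u (al (d k)) e * (F (d j) (d m) e * P (pb (x k)) (pb (x j)) e)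
     - u (x k) (pi e) * (F (d j) (d m) e *
       P (al (d k)) (pb (x j)) e)))); last first.
  move=> j _; rewrite sumrB lie_contract mulrBr !mulr_sumr; congr (_ - _);
  by apply: eq_bigr => i _; ring.
rewrite sumrB exchange_big /=.
rewrite (eq_bigr (fun i => - (l i * (m == i)%:R))); last first.
  by move=> i _; rewrite -mulr_sumr hor_contract dx mulrN.
rewrite sumrN delta.
rewrite exchange_big /=.
rewrite (eq_bigr (fun k => - (hor G u (al (d k)) e * (m == k)%:R) +
    u (x k) (pi e) * hor G (d m) (al (d k)) e)); last first.
  by move=> k _; rewrite sumrB -!mulr_sumr !hor_contract dx; ring.
rewrite big_split /= sumrN delta.
rewrite /F_rate => /eqP; rewrite subr_eq0 => /eqP K.
by rewrite -[LHS]opprK K opprD opprK.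
Qed.

(** Derivatives of [al] along [hor G u] cancel; the remaining ones, along the
    [hor G (d k)], subtract from [P] its horizontal part ([Upsilon_frame]). *)
Lemma hor_rate u f :
  \sum_i (F_rate i u * P (pb (x i)) f e -
     F (d i) u e * lie_derivative Z P (pb (x i)) f e) = Ups (al u) f e.
Proof.
rewrite sumrB lie_contract -sumrB.
have UT := bv_tangent Ups f e.
rewrite [RHS]bv_skewE (tangent_alpha u We UT) -sumrN.
rewrite (eq_bigr (fun k => u (x k) (pi e) * P (al (d k)) f e -
  \sum_m u (x m) (pi e) *
    (P (pb (x k)) f e * hor G (d k) (al (d m)) e))); last first.
  move=> k _; rewrite /F_rate mulrBl mulr_suml.
  rewrite [X in _ = _ - X](eq_bigr (fun i => u (x i) (pi e) *
    hor G (d k) (al (d i)) e * P (pb (x k)) f e)); first by ring.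
  by move=> i _; ring.
rewrite sumrB exchange_big -sumrB; apply: eq_bigr => k _ /=.
rewrite -mulr_sumr -mulrBr -(Upsilon_frame pis data fr We).
by rewrite (Upsilon_pull pis data) mulr0 addr0 [Ups f _ e]bv_skewE; ring.
Qed.

(** In the frame expansions of [al v], [al u] and [al [u, v]], the derivatives
    of the components of [u] and [v] cancel with the components of the
    bracket. *)
Lemma F_rate_dGamma (u v : vfield B) :
  \sum_m u (x m) (pi e) * F_rate m v =
  - (hor G u (al v) e - hor G v (al u) e - al (lie_bracket u v) e).
Proof.
have ht w := vat_tangent (hor G w) e.
have hal w w' : hor G w (al w') e = \sum_k (hor G w (al (d k)) e *
    w' (x k) (pi e) + al (d k) e * w (w' (x k)) (pi e)).
  have := tangent_alpha w' We (ht w); rewrite /vat => ->.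
  by apply: eq_bigr => k _; rewrite hor_pull pullE.
have -> : al (lie_bracket u v) e = \sum_k al (d k) e *
    (u (v (x k)) (pi e) - v (u (x k)) (pi e)) by exact: alpha_frame.
rewrite !hal -!sumrB -sumrN.
rewrite (eq_bigr (fun m => u (x m) (pi e) * hor G v (al (d m)) e -
  \sum_k v (x k) (pi e) *
    (u (x m) (pi e) * hor G (d m) (al (d k)) e))); last first.
  move=> m _; rewrite /F_rate mulrBr mulr_sumr; congr (_ - _).
  by apply: eq_bigr => k _; ring.
rewrite sumrB exchange_big -sumrB; apply: eq_bigr => k _ /=.
rewrite -mulr_sumr -(hor_frame pis _ fr We).
by ring.
Qed.

End At.
End Generator.

(** * Time derivatives of the geometric data *)

Section TimeDerivatives.
Context {R : realType} {E B : manifold R} (pi : E -> B).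
Hypothesis pis : smooth_map_on setT pi.
Local Notation I01 := (unit_interval : set R^o).
Local Notation pb := (pull pis).

Lemma base_frame (e : E) :
  exists n W (x : 'I_n -> Cinf B) (d : 'I_n -> vfield B),
    [/\ open W, W (pi e) & frame_on W x d].
Proof.
have [c cA cp] := atlas_cover (pi e).
have [x [d [W [oW Wp _ fr _]]]] := chart_frame cA cp.
by exists (mdim B), W, x, d.
Qed.

Variables (P : R -> bivector E) (Ups : bivector E).
Variables (Gamma : R -> connection pi) (F : R -> form2 pi).
Hypotheses (P_smooth : smooth_bfamily P) (F_smooth : smooth_form2_family F).
Hypothesis P_data : forall t, unit_interval t ->
  geometric_data (P t) Ups (Gamma t) (F t).
Variables (X : R -> vfield E) (h : R -> Cinf E).
Hypotheses (X_smooth : smooth_vfamily X) (h_smooth : smooth_family h).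
Hypothesis X_hor : forall t, unit_interval t -> forall e,
  hspace (Gamma t) e (vat (X t) e).

(** The one-form [al t] is the contraction of [F t] with the horizontal field
    [X - P_H^sharp dh].  To define it at a point without a frame, choose a
    covector [df] that [P] sends to [hor u]: then [F (w, u) = hor w f] for all
    [w], so the contraction is [X f + hor u h].  The frame expression shows that
    this is independent of [f] and smooth. *)
Lemma contraction_exists : exists al : R -> vfield B -> Cinf E,
  (forall u, smooth_family (fun t => al t u)) /\
  forall t, unit_interval t -> forall n W (x : 'I_n -> Cinf B) d,
    frame_on W x d -> forall e, W (pi e) -> forall u,
    al t u e = \sum_i F t (d i) u e *
      (X t (pb (x i)) e + P t (pb (x i)) (h t) e).
Proof.
pose A0 t u e (r : R) := exists f, [/\ annihilates_vertical pi e f,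
  forall g, P t f g e = hor (Gamma t) u g e &
  r = X t f e + hor (Gamma t) u (h t) e].
pose a u t e := get [set r | A0 t u e r].
have aE u t : unit_interval t -> forall n W (x : 'I_n -> Cinf B) d,
    frame_on W x d -> forall e, W (pi e) ->
    a u t e = \sum_i F t (d i) u e *
      (X t (pb (x i)) e + P t (pb (x i)) (h t) e).
  move=> t01 n W x d fr e We; have data := P_data t01.
  have [f [fv fP ->]] : A0 t u e (a u t e).
    have [f [fv fP]] := hor_annihilator data e u.
    apply: (@getPex _ [set r | A0 t u e r]).
    by exists (X t f e + hor (Gamma t) u (h t) e), f.
  rewrite (hor_coupling pis data fr We).
  have -> : X t f e = vat (X t) e f by [].
  rewrite (pairing_frame pis data fr We (X_hor t01 e) fv fP) -big_split.
  by apply: eq_bigr => i _; rewrite /vat /=; ring.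
have /choice[al alP] u : exists f, smooth_family f /\
    forall t, unit_interval t -> forall e, f t e = a u t e.
  apply: smooth_family_glue => p.
  have [n [W [x [d [oW Wp fr]]]]] := base_frame p.
  exists (pi @^-1` W), (fun t => \sum_i F t (d i) u *
    (X t (pb (x i)) + P t (pb (x i)) (h t))); split=> //.
  - by apply: open_comp => // ? _; exact: smooth_map_cont.
  - apply: smooth_family_sum => i; apply: smooth_familyM; first exact: F_smooth.
    apply: smooth_familyD; first exact: X_smooth.
    apply: (smooth_vfamily_apply (Y := fun t => sharp (P t) (pb (x i)))) => //.
    by move=> f; exact: P_smooth.
  move=> t t01 e We; rewrite (aE u t t01 n W x d fr e We) Cinf_sumE.
  by apply: eq_bigr => i _; rewrite CinfME CinfDE.
exists (fun t u => al u t); split=> [u|t t01 n W x d fr e We u].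
  exact: (alP u).1.
by rewrite (alP u).2// (aE u t t01 n W x d fr e We).
Qed.

Hypothesis P_poisson : forall t, unit_interval t -> poisson (P t).
Hypothesis generator : infinitesimal_generator P
  (fun t => vfield_add (X t) (sharp Ups (h t))).
Variable al : R -> vfield B -> Cinf E.
Hypothesis alE : forall t, unit_interval t ->
  forall n W (x : 'I_n -> Cinf B) d, frame_on W x d -> forall e, W (pi e) ->
  forall u, al t u e = \sum_i F t (d i) u e *
      (X t (pb (x i)) e + P t (pb (x i)) (h t) e).

Section Rates.
Variables (t : R) (t01 : unit_interval t) (e : E).
Variables (n : nat) (W : set B) (x : 'I_n -> Cinf B) (d : 'I_n -> vfield B).
Hypotheses (oW : open W) (We : W (pi e)) (fr : frame_on W x d).
Local Notation Z := (vfield_add (X t) (sharp Ups (h t))).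

(** The product rule in [hor_coupling], the bivector moving by the generator. *)
Lemma hor_derivative_frame u f (l : 'I_n -> R) :
  (forall i, is_derive_in I01 (fun s => F s (d i) u e) t 1 (l i)) ->
  is_derive_in I01 (fun s => hor (Gamma s) u f e) t 1
    (\sum_i (l i * P t (pb (x i)) f e -
       F t (d i) u e * lie_derivative Z (P t) (pb (x i)) f e)).
Proof.
move=> Fl.
apply: (@is_derive_in_ext _ _ _
  (fun s => \sum_i F s (d i) u e * P s (pb (x i)) f e)) => //.
  by move=> s s01; rewrite (hor_coupling pis (P_data s01) fr We).
apply: (@is_derive_in_sum _ _ _ _ _
  (fun i s => F s (d i) u e * P s (pb (x i)) f e)) => i.
rewrite -mulrN; apply: (@is_derive_inM _ _ _ (fun s => F s (d i) u e)) => //.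
exact: generator.2.
Qed.

Lemma F_derivative_frame u m :
  is_derive_in I01 (fun s => F s (d m) u e) t 1
    (F_rate (Gamma t) x d (al t) e m u).
Proof.
have /choice[l lP] i := smooth_family_derivable (F_smooth (d i) u) e t01.
rewrite -(F_rate_unique (P_data t01) (P_poisson t01) (X_hor t01) fr oW
  (alE t01 fr) We (l := l)) // => j.
have H := @hor_derivative_frame u (pb (x j)) l lP.
apply: (unit_interval_unique t01 H).
apply: (@is_derive_in_ext _ _ _ (cst (u (x j) (pi e)))) => //.
  by move=> s s01; rewrite hor_pull pullE.
exact: is_derive_in_cst.
Qed.

End Rates.

(** The first infinitesimal equation: the connection moves by the Hamiltonian
    fields, relative to [Ups], of the contraction. *)
Lemma hor_derivative t u f e : unit_interval t ->
  is_derive_in I01 (fun s => hor (Gamma s) u f e) t 1 (Ups (al t u) f e).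
Proof.
move=> t01; have [n [W [x [d [oW We fr]]]]] := base_frame e.
rewrite -(hor_rate (P_data t01) (P_poisson t01) (X_hor t01) fr oW
  (alE t01 fr) We).
apply: (hor_derivative_frame t01 We fr) => i.
exact: (F_derivative_frame t01 oW We fr).
Qed.

(** The second infinitesimal equation: the coupling form moves by the covariant
    differential of the contraction. *)
Lemma F_derivative t u v e : unit_interval t ->
  is_derive_in I01 (fun s => F s u v e) t 1
    (- (hor (Gamma t) u (al t v) e - hor (Gamma t) v (al t u) e -
        al t (lie_bracket u v) e)).
Proof.
move=> t01; have [n [W [x [d [oW We fr]]]]] := base_frame e.
rewrite -(F_rate_dGamma (P_data t01) fr oW (alE t01 fr) We).
apply: (@is_derive_in_ext _ _ _
  (fun s => \sum_m u (x m) (pi e) * F s (d m) v e)) => //.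
  move=> s s01; rewrite [F s u v]form2_alt CinfNE.
  rewrite (F_frame pis (P_data s01) fr We).
  rewrite -sumrN; apply: eq_bigr => m _.
  by rewrite [F s v _]form2_alt CinfNE mulrN opprK.
apply: (@is_derive_in_sum _ _ _ _ _
  (fun m s => u (x m) (pi e) * F s (d m) v e)) => m.
by apply: (@is_derive_inZ _ _ _ (fun s => F s (d m) v e));
  exact: (F_derivative_frame t01 oW We fr).
Qed.

End TimeDerivatives.

(** In a frame at [q] the bracket is a sum of products of a derivation of [A s]
    and a derivation of [C s], to which the ordinary product rule applies. *)
Lemma bracket_derivative (R : realType) (M : manifold R) (Q : bivector M)
    (A C : R -> Cinf M) (a c : Cinf M) (q : M) (t : R) :
  (forall v, tangent q v ->
    is_derive_in (unit_interval : set R^o) (fun s => v (A s)) t 1 (v a)) ->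
  (forall v, tangent q v ->
    is_derive_in (unit_interval : set R^o) (fun s => v (C s)) t 1 (v c)) ->
  is_derive_in (unit_interval : set R^o) (fun s => Q (A s) (C s) q) t 1
    (Q a (C t) q + Q (A t) c q).
Proof.
move=> Aa Cc; have [ch cA cq] := atlas_cover q.
have [x [d [W [oW Wq _ fr _]]]] := chart_frame cA cq.
have QE f g : Q f g q = \sum_i - (Q (x i) f q * d i g q).
  rewrite [LHS]((fr q Wq).2 _ (bv_tangent Q f q)).
  by apply: eq_bigr => i _; rewrite [Q f _ q]bv_skewE mulNr.
under eq_fun do rewrite QE.
rewrite !QE -big_split /=.
apply: (@is_derive_in_sum _ _ _ _ _
  (fun i s => - (Q (x i) (A s) q * d i (C s) q))) => i.
rewrite -opprD; apply: is_derive_inN.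
apply: (@is_derive_inM _ _ _ (fun s => Q (x i) (A s) q)
  (fun s => d i (C s) q)).
- exact: (Aa _ (bv_tangent Q (x i) q)).
- exact: (Cc _ (vat_tangent (d i) q)).
Qed.

(** * Integration of the infinitesimal equations *)

Theorem theorem2p19 (R : realType) (E B : manifold R) (pi : E -> B)
    (pi_bundle : fiber_bundle pi)
    (P : R -> bivector E) (Upsilon : bivector E)
    (Gamma : R -> connection pi) (F : R -> form2 pi)
    (P_smooth : smooth_bfamily P)
    (Gamma_smooth : smooth_connection_family Gamma)
    (F_smooth : smooth_form2_family F)
    (P_coupling : forall t, unit_interval t -> coupling_poisson pi (P t))
    (P_data : forall t, unit_interval t ->
       geometric_data (P t) Upsilon (Gamma t) (F t))
    (hyp_a : exists Q : R -> form1 pi,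
       smooth_form1_family Q /\
       forall t, unit_interval t -> forall (u : vfield B) (f : Cinf E),
         hor (Gamma t) u f = hor (Gamma 0) u f + sharp Upsilon (Q t u) f)
    (hyp_b : exists (X : R -> vfield E) (h : R -> Cinf E),
       [/\ smooth_vfamily X, smooth_family h,
           (forall t, unit_interval t -> forall e : E,
              hspace (Gamma t) e (vat (X t) e)) &
           infinitesimal_generator P
             (fun t => vfield_add (X t) (sharp Upsilon (h t)))]) :
  exists Q : R -> form1 pi,
    [/\ smooth_form1_family Q,
        (forall t, unit_interval t -> forall (u : vfield B) (f : Cinf E),
           hor (Gamma t) u f = hor (Gamma 0) u f + sharp Upsilon (Q t u) f) &
        (forall t, unit_interval t -> forall u v : vfield B,
           F t u v = F 0 u v -
             (dGamma (Gamma 0) (Q t) u v +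
              2^-1 *: bracket_wedge Upsilon (Q t) u v))].
Proof.
have [pis _ _] := pi_bundle.
have [X [h [Xs hs Xh gen]]] := hyp_b.
have [al [als alE]] := contraction_exists pis P_smooth F_smooth P_data Xs hs Xh.
have P_poisson t : unit_interval t -> poisson (P t) by case/P_coupling.
have hor_dt := hor_derivative F_smooth P_data Xh P_poisson gen alE.
have F_dt := F_derivative F_smooth P_data Xh P_poisson gen alE.
have I0 : unit_interval (0 : R) by rewrite /unit_interval /= lexx ler01.
(* [A u t] is the integral of [al s u] over [0, t]; it becomes a one-form in [u]
   because two primitives with the same derivative agree. *)
have /choice[A AP] u := smooth_family_primitive (als u).
have A0 u : A u 0 = 0 by apply: Cinf_eq => e; have [_ ->] := AP u.
have A_dt u e t : unit_interval t ->
    is_derive_in (unit_interval : set R^o) (fun s => A u s e) t 1 (al t u e).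
  by have [_ _ + _] := AP u; exact.
have vA_dt u e v t : tangent e v -> unit_interval t ->
    is_derive_in (unit_interval : set R^o) (fun s => v (A u s)) t 1
      (v (al t u)).
  by move=> vt t01; have [_ _ _ H] := AP u; exact: (H e).
have alD t u v e : unit_interval t ->
    al t (vfield_add u v) e = al t u e + al t v e.
  move=> t01; have [n [W [x [d [oW We fr]]]]] := base_frame pi e.
  rewrite !(alE t t01 _ _ _ _ fr e We) -big_split; apply: eq_bigr => i _ /=.
  by rewrite form2D CinfDE mulrDl.
have alZ t b u e : unit_interval t ->
    al t (vfield_scale b u) e = b (pi e) * al t u e.
  move=> t01; have [n [W [x [d [oW We fr]]]]] := base_frame pi e.
  rewrite !(alE t t01 _ _ _ _ fr e We) mulr_sumr; apply: eq_bigr => i _.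
  by rewrite form2Z mulrA.
have AD u v t e : unit_interval t ->
    A (vfield_add u v) t e = A u t e + A v t e.
  move: t; apply: (@unit_interval_eq _ _ (fun t => A u t e + A v t e)
    (fun t => al t u e + al t v e)) => [t t01|t t01|].
  - by rewrite -alD//; exact: A_dt.
  - by apply: (is_derive_inD (f := fun t => A u t e)); exact: A_dt.
  - by rewrite !A0 Cinf0E addr0.
have AZ b u t e : unit_interval t ->
    A (vfield_scale b u) t e = b (pi e) * A u t e.
  move: t; apply: (@unit_interval_eq _ _ (fun t => b (pi e) * A u t e)
    (fun t => b (pi e) * al t u e)) => [t t01|t t01|].
  - by rewrite -alZ//; exact: A_dt.
  - by apply: (is_derive_inZ (f := fun t => A u t e)); exact: A_dt.
  - by rewrite !A0 Cinf0E mulr0.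
have /choice[Q QE] t : exists q : form1 pi, unit_interval t ->
    forall u, q u = A u t.
  have [t01|nt01] := pselect (unit_interval t).
    have qD u v : A (vfield_add u v) t = A u t + A v t.
      by apply: Cinf_eq => e; rewrite AD.
    by exists (Form1 qD (fun b u e => AZ b u t e t01)).
  have zD (u v : vfield B) : (0 : Cinf E) = 0 + 0 by rewrite addr0.
  have zZ (b : Cinf B) (u : vfield B) e :
      (0 : Cinf E) e = b (pi e) * (0 : Cinf E) e.
    by rewrite Cinf0E mulr0.
  by exists (Form1 (form1_fun := fun=> 0) zD zZ).
have Q_hor t : unit_interval t -> forall u f,
    hor (Gamma t) u f = hor (Gamma 0) u f + sharp Upsilon (Q t u) f.
  move=> t01 u f; apply: Cinf_eq => e; rewrite QE// CinfDE.
  move: t t01; apply: (@unit_interval_eq _ (fun t => hor (Gamma t) u f e)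
    (fun t => hor (Gamma 0) u f e + Upsilon (A u t) f e)
    (fun t => Upsilon (al t u) f e)) => [t t01|t t01|].
  - exact: hor_dt.
  - rewrite -[X in is_derive_in _ _ _ _ X]add0r.
    apply: is_derive_inD; first exact: is_derive_in_cst.
    have /is_derive_inN := vA_dt u e _ t (bv_tangent Upsilon f e) t01.
    rewrite -[X in is_derive_in _ _ _ _ X]bv_skewE.
    by under eq_fun do rewrite -bv_skewE.
  - by rewrite A0 bv_skewE (tangent0 (bv_tangent Upsilon f e)) oppr0 addr0.
exists Q; split=> //.
  move=> u c cA; have [As _ _ _] := AP u.
  by apply: smooth_on_ext (As c cA) => z [z0 _]; rewrite QE.
move=> t t01 u v; apply: Cinf_eq => e.
rewrite CinfBE CinfDE CinfZE /dGamma /bracket_wedge !QE// !CinfBE.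
move: t t01.
(* [g] is the right-hand side, with the two equal halves of the bracket
   merged. *)
pose g t := F 0 u v e - (hor (Gamma 0) u (A v t) e - hor (Gamma 0) v (A u t) e -
  A (lie_bracket u v) t e + Upsilon (A u t) (A v t) e).
suff E' t : unit_interval t -> F t u v e = g t.
  move=> t t01; rewrite E'// /g [Upsilon (A v t) _ _]bv_skewE.
  by congr (_ - (_ + _)); field.
apply: (@unit_interval_eq _ (fun t => F t u v e) g (fun t =>
  - (hor (Gamma t) u (al t v) e - hor (Gamma t) v (al t u) e -
        al t (lie_bracket u v) e))) => {t} [t t01|t t01|].
- exact: F_dt.
- have bd := bracket_derivative (Q := Upsilon) (q := e)
    (fun w wt => vA_dt u e w t wt t01) (fun w wt => vA_dt v e w t wt t01).
  have hd w w' := vA_dt w' e _ t (vat_tangent (hor (Gamma 0) w) e) t01.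
  (* Replacing [Gamma t] by [Gamma 0] with [Q_hor] produces the derivative of
     the bracket. *)
  have -> : - (hor (Gamma t) u (al t v) e - hor (Gamma t) v (al t u) e -
        al t (lie_bracket u v) e) = 0 +
      - (hor (Gamma 0) u (al t v) e + - hor (Gamma 0) v (al t u) e +
        - al t (lie_bracket u v) e +
        (Upsilon (al t u) (A v t) e + Upsilon (A u t) (al t v) e)).
    rewrite !(Q_hor t t01) !CinfDE /= !QE// [Upsilon (A v t) _ e]bv_skewE.
    by ring.
  apply: is_derive_inD; first exact: is_derive_in_cst.
  apply: is_derive_inN; apply: is_derive_inD; last exact: bd.
  apply: is_derive_inD; last by apply: is_derive_inN; exact: A_dt.
  by apply: is_derive_inD; [exact: hd|apply: is_derive_inN; exact: hd].
- rewrite /g !A0 (tangent0 (bv_tangent Upsilon _ e)).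
  rewrite [hor _ u 0 e](tangent0 (vat_tangent _ e)).
  rewrite [hor _ v 0 e](tangent0 (vat_tangent _ e)) Cinf0E.
  by rewrite !subr0 addr0 subr0.
Qed.
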